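(* Let $M_{\bullet\bullet}$ be a $\Delta_2$-space. 1. Let $\mathcal A_\bullet=(\mathcal A_0\stackrel{d}{\to}\mathcal A_1\stackrel{d}{\to}\cdots)$ be a complex of abelian sheaves over $M_{\bullet\bullet}$. For each $k\in\mathbb N$ there is a map $T_k:C^*(M_{0,\bullet};\mathcal A_\bullet)\to C^{*-k}(M_{k,\bullet};\mathcal A_\bullet)$ (with $T_0=\mathrm{Id}$) such that $T=\sum_{k\ge0}T_k:C^*(M_{0,\bullet};\mathcal A_\bullet)\to C^*(M_{\bullet\bullet};\mathcal A_\bullet)$ is a chain map, which therefore induces a morphism $T:H^*(M_{0,\bullet};\mathcal A_\bullet)\to H^*(M_{\bullet\bullet};\mathcal A_\bullet)$ on the level of cohomology. 2. In particular, $T_1:C^*(M_{0,\bullet};\mathcal A_\bullet)\to C^{*-1}(M_{1,\bullet};\mathcal A_\bullet)$ is an (anti-)chain map and thus induces a morphism $T_1:H^*(M_{0,\bullet};\mathcal A_\bullet)\to H^{*-1}(M_{1,\bullet};\mathcal A_\bullet)$. 3. Similarly, given an abelian sheaf $\mathcal A$ over $M_{\bullet\bullet}$, there is for each $k\in\mathbb N$ a map $T_k:\check C^*(M_{0,\bullet};\mathcal A)\to\check C^{*-k}(M_{k,\bullet};\mathcal A)$ (with $T_0=\mathrm{Id}$) such that $T=\sum_{k\ge0}T_k:\check C^*(M_{0,\bullet};\mathcal A)\to\check C^*(M_{\bullet\bullet};\mathcal A)$ is a chain map, which therefore induces a morphism $T:\check H^*(M_{0,\bullet};\mathcal A)\to\check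 H^*(M_{\bullet\bullet};\mathcal A)$. 4. Similarly, for any abelian sheaf $\mathcal A$ over $M_{\bullet\bullet}$, $T_1:\check C^*(M_{0,\bullet};\mathcal A)\to\check C^{*-1}(M_{1,\bullet};\mathcal A)$ is an (anti-)chain map and thus induces a morphism $T_1:\check H^*(M_{0,\bullet};\mathcal A)\to\check H^{*-1}(M_{1,\bullet};\mathcal A)$. $T$ is called the total transgression map and $T_1$ the transgression map.
   Context: **Categories.** $\Delta$ is the simplicial category: objects $k\in\mathbb N$, morphisms $k\to k'$ the nondecreasing maps $[k]\to[k']$, where $[k]=\{0,\dots,k\}$; $\varepsilon_i:[k]\to[k+1]$ is the increasing map omitting $i$. The category $\Delta_2$ has objects $(k,l)\in\mathbb N^2$; a morphism $(k,l)\to(k',l')$ is a triple $(a,b,c)$ with $a\in\{\emptyset\}\cup\mathrm{Hom}_\Delta(k,k')$, $b\in\{\emptyset\}\cup\mathrm{Hom}_\Delta(l,k')$, $c\in\mathrm{Hom}_\Delta(l,l')$, and $a=\emptyset$ or $b=\emptyset$. Composition: $(a',\emptyset,c')\circ(a,\emptyset,c)=(a'\circ a,\emptyset,c'\circ c)$, $(a',\emptyset,c')\circ(\emptyset,b,c)=(\emptyset,a'\circ b,c'\circ c)$, $(\emptyset,b',c')\circ(a,b,c)=(\emptyset,b'\circ c,c'\circ c)$. The degree of a morphism $(k,l)\to(k',l')$ is $k'+l'-k-l$. **Spaces and sheaves.** A $\mathcal C$-space is a contravariant functor $M$ from $\mathcal C$ to topological spaces; a morphism $f:i\to j$ gives $\tilde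 f:M_j\to M_i$. An abelian sheaf on it is a family of abelian sheaves on the spaces $M_i$ together with, for each morphism $f:i\to j$ and open $U\subset M_i$, $V\subset M_j$ with $\tilde f(V)\subset U$, a restriction map $\tilde f^*:\mathcal A(U)\to\mathcal A(V)$, functorially: $(\tilde f\circ\tilde g)^*=\tilde g^*\circ\tilde f^*$. For fixed $k$, $M_{k,\bullet}=(M_{k,l})_{l\in\mathbb N}$ is a simplicial space via the morphisms $(\mathrm{Id},\emptyset,c)$. **Cochains.** $\partial=\sum_i(-1)^i\tilde\varepsilon_i^*:\mathcal A_q(M_{k,p})\to\mathcal A_q(M_{k,p+1})$, using the morphisms $(\mathrm{Id},\emptyset,\varepsilon_i)$, and $\partial'=\sum_i(-1)^i\tilde\varepsilon_i'^*:\mathcal A_q(M_{k,p})\to\mathcal A_q(M_{k+1,p})$, using $(\varepsilon_i,\emptyset,\mathrm{Id})$. $C^n(M_{k,\bullet};\mathcal A_\bullet)=\bigoplus_{p+q=n}\mathcal A_q(M_{k,p})$ with total differential $(-1)^pd+\partial$; $C^n(M_{\bullet\bullet};\mathcal A_\bullet)=\bigoplus_{k+p+q=n}\mathcal A_q(M_{k,p})=\bigoplus_kC^{n-k}(M_{k,\bullet};\mathcal A_\bullet)$ with total differential $(-1)^{k+p}d+(-1)^k\partial+\partial'$. $H^*(-;\mathcal A_\bullet)$ denotes the cohomology of these complexes. **Čech cochains.** For an open cover $\mathcal U=(U^{k,l}_i)_{i\in I_{k,l}}$ of the spaces $M_{k,l}$, $\sigma\mathcal U$ is the cover indexed by $\Lambda_{k,l}=\{\lambda=(\lambda_f)\}$,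 $f$ running over the morphisms of $\Delta_2$ of degree $\ge0$ with target $(k,l)$, $\lambda_f\in I_{s(f)}$ ($s(f)$ the source of $f$), with $V_\lambda=\bigcap_f\tilde f^{-1}(U_{\lambda_f})$ and $(\tilde h\lambda)_g=\lambda_{h\circ g}$. With $M'_{k,l}=\coprod_{\lambda\in\Lambda_{k,l}}V_\lambda$, the spaces $M'_{k,l}$ are contravariantly functorial for morphisms of degree $\ge0$, and $\mathcal A(M'_{k,l})=\prod_\lambda\mathcal A(V_\lambda)$. The Čech complexes $\check C^*(M_{k,\bullet};\mathcal A)$ and $\check C^*(M_{\bullet\bullet};\mathcal A)$ are the direct limits, over covers of the form $(U_x)_x$ with $U_x$ an open neighbourhood of $x$, ordered by pointwise inclusion, of the complexes with degree $n$ parts $\mathcal A(M'_{k,n})$, differential $\partial$, and $\bigoplus_{k+p=n}\mathcal A(M'_{k,p})$, differential $\partial'+(-1)^k\partial$. $\check H^*$ denotes their cohomology. **The maps $T_k$ constructed.** $S_{k,l}$ is the set of $(k,l)$-shuffles, i.e. permutations $\sigma$ of $\{1,\dots,k+l\}$ with $\sigma(1)<\dots<\sigma(k)$ and $\sigma(k+1)<\dots<\sigma(k+l)$, with signature $\varepsilon(\sigma)$. For $\sigma\in S_{k,l}$ let $f_\sigma=(\emptyset,b^\sigma,c^\sigma):(0,k+l)\to(k,l)$, where $b^\sigma(i)=\#(\sigma(\{1,\dots,k\})\cap\{1,\dots,i\})$ and $c^\sigma(i)=\#(\sigma(\{k+1,\dots,k+l\})\cap\{1,\dots,i\})$. Then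 $T_k=\sum_{\sigma\in S_{k,l}}\varepsilon(\sigma)\tilde f_\sigma^*$ on (Čech) cochains over $M_{0,k+l}$, with $T_0=\mathrm{Id}$.
   Formalization: T_0=Id and items 2 and 4 fail over the literal Δ_2, where the shuffle T_0 is the action of (∅,const,Id); they are proved over the quotient of Δ_2 identifying constant components a, b with ∅, while T (with the shuffle T_0) is shown to be a chain map inducing a map on cohomology over both. *)

(* Defs.v *)
From HB Require Import structures.
From mathcomp Require Import all_boot all_order all_algebra.
From mathcomp Require Import perm generic_quotient ring_quotient.
From mathcomp Require Import boolp classical_sets functions filter topology.

Set Implicit Arguments.
Unset Strict Implicit.
Unset Printing Implicit Defensive.

Import GRing.Theory.

Local Open Scope ring_scope.
Local Open Scope classical_set_scope.

Definition mkadd (U V : zmodType) (f : U -> V) (h : zmod_morphism f) :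
    {additive U -> V} :=
  HB.pack f (GRing.isZmodMorphism.Build U V f h).

Section DepProduct.
Variables (I : Type) (G : I -> zmodType).

Definition dprod : Type := forall i, G i.

HB.instance Definition _ := gen_eqMixin dprod.
HB.instance Definition _ := gen_choiceMixin dprod.

Let add (x y : dprod) : dprod := fun i => x i + y i.
Let opp (x : dprod) : dprod := fun i => - x i.
Let zero : dprod := fun _ => 0.

Lemma dprod_addA : associative add.
Proof. by move=> x y z; apply: functional_extensionality_dep => i; exact: addrA. Qed.
Lemma dprod_addC : commutative add.
Proof. by move=> x y; apply: functional_extensionality_dep => i; exact: addrC. Qed.
Lemma dprod_add0 : left_id zero add.
Proof. by move=> x; apply: functional_extensionality_dep => i; exact: add0r. Qed.
Lemma dprod_addN : left_inverse zero opp add.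
Proof. by move=> x; apply: functional_extensionality_dep => i; exact: addNr. Qed.

HB.instance Definition _ :=
  GRing.isZmodule.Build dprod dprod_addA dprod_addC dprod_add0 dprod_addN.

Lemma dprodB (x y : dprod) i : (x - y) i = x i - y i. Proof. by []. Qed.
Lemma dprod0 i : (0 : dprod) i = 0. Proof. by []. Qed.
Lemma dprodP (x y : dprod) : (forall i, x i = y i) -> x = y.
Proof. exact: functional_extensionality_dep. Qed.

End DepProduct.

(* [gr deg G n] is the direct sum of the G i over the indices i of degree
   deg i = n, realised as the families vanishing at all other indices (each
   degree has finitely many indices in all uses below).  This spares casts
   along equations such as k + p + q = n. *)
Section GradedPiece.
Variables (I : Type) (deg : I -> nat) (G : I -> zmodType).

Definition in_degree (n : nat) : pred (dprod G) :=
  fun x => `[< forall i, deg i != n -> x i = 0 >].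

Lemma in_degreeP n x :
  reflect (forall i, deg i != n -> x i = 0) (x \in in_degree n).
Proof. exact: asboolP. Qed.

Lemma in_degree_closed n : zmod_closed (in_degree n).
Proof.
split; first by apply/in_degreeP => i _.
move=> x y /in_degreeP hx /in_degreeP hy; apply/in_degreeP => i hi.
by rewrite dprodB hx // hy // subrr.
Qed.

HB.instance Definition _ n :=
  GRing.isZmodClosed.Build (dprod G) (in_degree n) (in_degree_closed n).

Record gr (n : nat) := Gr { gr_val :> dprod G; _ : gr_val \in in_degree n }.

HB.instance Definition _ n := [isSub for @gr_val n].
HB.instance Definition _ n := [Choice of gr n by <:].
HB.instance Definition _ n := [SubChoice_isSubZmodule of gr n by <:].

Lemma gr_out n (x : gr n) i : deg i != n -> gr_val x i = 0.
Proof. by move: i; apply/in_degreeP; case: x. Qed.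

End GradedPiece.

Section GradedMap.
Variables (I I' : Type) (deg : I -> nat) (deg' : I' -> nat).
Variables (G : I -> zmodType) (G' : I' -> zmodType) (n n' : nat).
Variables (phi : dprod G -> dprod G') (phiB : zmod_morphism phi).
Hypothesis phi_deg :
  forall x, x \in in_degree deg n -> phi x \in in_degree deg' n'.

Definition gr_map_fun (x : gr deg G n) : gr deg' G' n' :=
  Gr (phi_deg (valP x)).

Lemma gr_map_funB : zmod_morphism gr_map_fun.
Proof. by move=> x y; apply: val_inj; exact: phiB. Qed.

Definition gr_map : {additive gr deg G n -> gr deg' G' n'} := mkadd gr_map_funB.

End GradedMap.

(* [d \o d = 0], which holds for all complexes below, is not a field: coho is
   Ker d / (Ker d :&: Im d), that is Ker d / Im d when [d \o d = 0]. *)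
Record cochains := Cochains {
  coch :> nat -> zmodType;
  cdiff : forall n, {additive coch n -> coch n.+1} }.

Arguments cdiff {c n}.

Section Cohomology.
Variables (C : cochains) (n : nat).

Definition cocycle : pred (C n) := fun x => cdiff x == 0.

Lemma cocycle_closed : zmod_closed cocycle.
Proof.
split; first by rewrite unfold_in raddf0.
by move=> x y; rewrite !unfold_in raddfB => /eqP -> /eqP ->; rewrite subrr.
Qed.

HB.instance Definition _ := GRing.isZmodClosed.Build (C n) cocycle cocycle_closed.

Record cocycles := Cocycle { cocycle_val :> C n; _ : cocycle_val \in cocycle }.

HB.instance Definition _ := [isSub for cocycle_val].
HB.instance Definition _ := [Choice of cocycles by <:].
HB.instance Definition _ := [SubChoice_isSubZmodule of cocycles by <:].

End Cohomology.

Definition is_coboundary (C : cochains) (n : nat) : C n -> Prop :=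
  match n with
  | 0 => fun x => x = 0
  | m.+1 => fun x => exists y : C m, cdiff y = x
  end.

Definition coboundary (C : cochains) (n : nat) : pred (cocycles C n) :=
  fun x => `[< is_coboundary (cocycle_val x) >].

Lemma coboundary_closed (C : cochains) n : zmod_closed (@coboundary C n).
Proof.
split; first by apply/asboolP; case: n => [|n] //=; exists 0; rewrite raddf0.
move=> x y /asboolP hx /asboolP hy; apply/asboolP.
case: n x y hx hy => [|n] x y /=; first by move=> -> ->; rewrite subrr.
by move=> [u <-] [v <-]; exists (u - v); rewrite raddfB.
Qed.

Definition coboundaries (C : cochains) n : zmodClosed (cocycles C n) :=
  HB.pack (@coboundary C n)
    (GRing.isZmodClosed.Build _ (@coboundary C n) (@coboundary_closed C n)).

Definition coho (C : cochains) (n : nat) : zmodType :=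
  Quotient.quot (coboundaries C n).

Definition coho_class (C : cochains) n (x : C n) (hx : cdiff x = 0) : coho C n :=
  \pi_(Quotient.quot (coboundaries C n))%qT (@Cocycle C n x (introT eqP hx)).

Definition chain_map (C C' : cochains) (f : forall n, {additive C n -> C' n}) :=
  forall n (x : C n), cdiff (f n x) = f n.+1 (cdiff x).

(* A map of degree -1; the first clause is the condition in degree 0, where
   the target of f vanishes. *)
Definition antichain_map (C C' : cochains)
    (f : forall n, {additive C n.+1 -> C' n}) :=
  (forall x : C 0, f 0 (cdiff x) = 0) /\
  (forall n (x : C n.+1), cdiff (f n x) = - f n.+1 (cdiff x)).

Definition induces_on_coho (s : nat) (C C' : cochains)
    (f : forall n, {additive C (s + n)%N -> C' n}) :=
  exists F : forall n, {additive coho C (s + n)%N -> coho C' n},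
  forall n (x : C (s + n)%N) (hx : cdiff x = 0),
  exists hfx : cdiff (f n x) = 0, F n (coho_class hx) = coho_class hfx.

Record dirset := Dirset {
  dcar :> Type;
  dle : dcar -> dcar -> Prop;
  dtop : dcar;
  dsup : dcar -> dcar -> dcar;
  dle_refl : forall i, dle i i;
  dle_trans : forall i j k, dle i j -> dle j k -> dle i k;
  dle_supl : forall i j, dle i (dsup i j);
  dle_supr : forall i j, dle j (dsup i j) }.

Record dirsys (D : dirset) := Dirsys {
  dgrp :> D -> zmodType;
  dres : forall i j, dle i j -> {additive dgrp i -> dgrp j};
  dres_id : forall i (h : dle i i) x, dres h x = x;
  dres_comp : forall i j k (h : dle i j) (h' : dle j k) (h'' : dle i k) x,
    dres h'' x = dres h' (dres h x) }.

Section Colimit.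
Variables (D : dirset) (S : dirsys D).

Definition deltas : Type := {classic {i : D & S i}}.

Definition deltas_eq : rel deltas := fun x y =>
  `[< exists k (hx : dle (projT1 x) k) (hy : dle (projT1 y) k),
        dres S hx (projT2 x) = dres S hy (projT2 y) >].

Lemma deltas_equiv : equiv_class_of deltas_eq.
Proof.
split.
- by move=> [i x]; apply/asboolP; exists i, (dle_refl i), (dle_refl i).
- move=> x y; apply/asboolP/asboolP => -[k [h1 [h2 e]]];
    by exists k, h2, h1.
- move=> y x z /asboolP[k [hx [hy e]]] /asboolP[l [hy' [hz e']]].
  apply/asboolP; pose m := dsup k l.
  have hk : dle k m by exact: dle_supl.
  have hl : dle l m by exact: dle_supr.
  exists m, (dle_trans hx hk), (dle_trans hz hl).
  rewrite (dres_comp hx hk) e (dres_comp hz hl) -e'.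
  rewrite -(dres_comp hy hk (dle_trans hy hk)).
  by rewrite -(dres_comp hy' hl (dle_trans hy hk)).
Qed.

Canonical deltas_equiv_rel := EquivRelPack deltas_equiv.

Definition colim : Type := {eq_quot deltas_eq}%qT.

HB.instance Definition _ := Choice.on colim.
HB.instance Definition _ := EqQuotient.on colim.

Definition colim_in (i : D) (x : S i) : colim :=
  \pi_colim%qT (existT (fun i => S i : Type) i x : deltas).

Lemma colim_inP (c : colim) : exists i (x : S i), c = colim_in x.
Proof.
exists (projT1 (repr c)), (projT2 (repr c)).
by rewrite /colim_in; case: (repr c) (reprK c) => i x /= ->.
Qed.

Lemma colim_in_eq i j (x : S i) (y : S j) :
  colim_in x = colim_in y <->
  exists k (hx : dle i k) (hy : dle j k), dres S hx x = dres S hy y.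
Proof.
split; first by move/eqmodP/asboolP.
by move=> h; apply/eqmodP/asboolP.
Qed.

Lemma colim_in_res i j (h : dle i j) (x : S i) :
  colim_in (dres S h x) = colim_in x.
Proof.
apply/colim_in_eq; exists j, (dle_refl j), h.
by rewrite dres_id.
Qed.

Definition colim_add (c c' : colim) : colim :=
  let x := repr c in let y := repr c' in
  colim_in (dres S (dle_supl (projT1 x) (projT1 y)) (projT2 x) +
            dres S (dle_supr (projT1 x) (projT1 y)) (projT2 y)).

Definition colim_opp (c : colim) : colim := colim_in (- projT2 (repr c)).

Definition colim_zero : colim := colim_in (0 : S (dtop D)).

Lemma colim_repr i (x : S i) :
  exists k (h : dle (projT1 (repr (colim_in x))) k) (h' : dle i k),
    dres S h (projT2 (repr (colim_in x))) = dres S h' x.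
Proof.
apply/(@colim_in_eq _ _ (projT2 (repr (colim_in x))) x).
rewrite {1}/colim_in.
by case: (repr (colim_in x)) (reprK (colim_in x)) => j y /= ->.
Qed.

Lemma colim_addE i (x y : S i) :
  colim_add (colim_in x) (colim_in y) = colim_in (x + y).
Proof.
rewrite /colim_add; have [k [h1 [h2 e]]] := colim_repr x.
have [l [h3 [h4 e']]] := colim_repr y.
move: (repr (colim_in x)) (repr (colim_in y)) h1 h3 e e'
  => -[/= a u] [/= b v] h1 h3 e e'.
apply/colim_in_eq; pose s := dsup a b; pose m := dsup s (dsup k l).
have hs : dle s m by exact: dle_supl.
have hk : dle k m by exact: dle_trans (dle_supl k l) (dle_supr s _).
have hl : dle l m by exact: dle_trans (dle_supr k l) (dle_supr s _).
exists m, hs, (dle_trans h2 hk); rewrite !raddfD; congr (_ + _).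
- rewrite -(dres_comp _ _ (dle_trans h1 hk)) (dres_comp h1 hk) e.
  by rewrite -(dres_comp h2 hk (dle_trans h2 hk)).
- rewrite -(dres_comp _ _ (dle_trans h3 hl)) (dres_comp h3 hl) e'.
  by rewrite -(dres_comp h4 hl (dle_trans h2 hk)).
Qed.

Lemma colim_oppE i (x : S i) : colim_opp (colim_in x) = colim_in (- x).
Proof.
rewrite /colim_opp; have [k [h1 [h2 e]]] := colim_repr x.
by apply/colim_in_eq; exists k, h1, h2; rewrite !raddfN e.
Qed.

Lemma colim_zeroE i : colim_zero = colim_in (0 : S i).
Proof.
apply/colim_in_eq; exists (dsup (dtop D) i), (dle_supl _ _), (dle_supr _ _).
by rewrite !raddf0.
Qed.

Lemma colim_in2P (c c' : colim) :
  exists i (x y : S i), c = colim_in x /\ c' = colim_in y.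
Proof.
have [i [x ->]] := colim_inP c; have [j [y ->]] := colim_inP c'.
exists (dsup i j), (dres S (dle_supl i j) x), (dres S (dle_supr i j) y).
by rewrite !colim_in_res.
Qed.

Lemma colim_addA : associative colim_add.
Proof.
move=> a b c; have [i [x [y [-> ->]]]] := colim_in2P a b.
have [j [z ->]] := colim_inP c.
rewrite -(colim_in_res (dle_supl i j) x) -(colim_in_res (dle_supl i j) y).
rewrite -(colim_in_res (dle_supr i j) z).
by rewrite !colim_addE addrA.
Qed.

Lemma colim_addC : commutative colim_add.
Proof.
by move=> a b; have [i [x [y [-> ->]]]] := colim_in2P a b;
  rewrite !colim_addE addrC.
Qed.

Lemma colim_add0 : left_id colim_zero colim_add.
Proof.
move=> a; have [i [x ->]] := colim_inP a.
by rewrite (colim_zeroE i) colim_addE add0r.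
Qed.

Lemma colim_addN : left_inverse colim_zero colim_opp colim_add.
Proof.
move=> a; have [i [x ->]] := colim_inP a.
by rewrite colim_oppE colim_addE addNr -colim_zeroE.
Qed.

HB.instance Definition _ :=
  GRing.isZmodule.Build colim colim_addA colim_addC colim_add0 colim_addN.

Lemma colim_inB i (x y : S i) : colim_in (x - y) = colim_in x - colim_in y.
Proof. by rewrite -colim_addE -colim_oppE. Qed.

End Colimit.

Record dirmor (D : dirset) (S S' : dirsys D) := Dirmor {
  dmor :> forall i, {additive S i -> S' i};
  dmor_res : forall i j (h : dle i j) x,
    dmor j (dres S h x) = dres S' h (dmor i x) }.

Section ColimitMap.
Variables (D : dirset) (S S' : dirsys D) (phi : dirmor S S').

Definition colim_map_fun (c : colim S) : colim S' :=
  colim_in (phi _ (projT2 (repr c))).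

Lemma colim_map_funE i (x : S i) :
  colim_map_fun (colim_in x) = colim_in (phi i x).
Proof.
have [k [h1 [h2 e]]] := colim_repr x.
by apply/colim_in_eq; exists k, h1, h2; rewrite -!dmor_res e.
Qed.

Lemma colim_map_funB : zmod_morphism colim_map_fun.
Proof.
move=> a b; have [i [x [y [-> ->]]]] := colim_in2P a b.
by rewrite -colim_inB !colim_map_funE raddfB colim_inB.
Qed.

Definition colim_map : {additive colim S -> colim S'} := mkadd colim_map_funB.

End ColimitMap.

Definition is_nondec k l (f : {ffun 'I_k.+1 -> 'I_l.+1}) : bool :=
  [forall i : 'I_k.+1, forall j : 'I_k.+1, (i <= j)%N ==> (f i <= f j)%N].

Definition dhom k l := {f : {ffun 'I_k.+1 -> 'I_l.+1} | is_nondec f}.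

Definition mkdhom k l (f : {ffun 'I_k.+1 -> 'I_l.+1}) (h : is_nondec f) :
  dhom k l := exist (fun f => is_nondec f) f h.

Lemma dhom_nondec k l (f : dhom k l) (i j : 'I_k.+1) :
  (i <= j)%N -> (val f i <= val f j)%N.
Proof. by move=> hij; have /forallP/(_ i)/forallP/(_ j)/implyP := valP f; apply. Qed.

Lemma did_subproof k : is_nondec [ffun i : 'I_k.+1 => i].
Proof.
by apply/forallP => i; apply/forallP => j; apply/implyP; rewrite !ffunE.
Qed.

Definition did k : dhom k k := mkdhom (did_subproof k).

Lemma dcomp_subproof k l m (g : dhom l m) (f : dhom k l) :
  is_nondec [ffun i => val g (val f i)].
Proof.
apply/forallP => i; apply/forallP => j; apply/implyP => hij; rewrite !ffunE.
by apply: dhom_nondec; apply: dhom_nondec.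
Qed.

Definition dcomp k l m (g : dhom l m) (f : dhom k l) : dhom k m :=
  mkdhom (dcomp_subproof g f).

Lemma dface_subproof k (i : 'I_k.+2) : is_nondec [ffun j : 'I_k.+1 => lift i j].
Proof.
apply/forallP => a; apply/forallP => b; apply/implyP => hab; rewrite !ffunE /=.
by rewrite leq_bump2.
Qed.

Definition dface k (i : 'I_k.+2) : dhom k k.+1 := mkdhom (dface_subproof i).

Definition is_const k l (f : dhom k l) : bool := [forall i, val f i == val f ord0].

Definition obj : Type := (nat * nat)%type.

(* Two variants of Delta_2, selected by a boolean r; the value None of a
   component is written 0 here.
   - r = false: all triples (a, b, c) with a = 0 or b = 0, composed by
     (a',0,c')(a,0,c) = (a'a,0,c'c), (a',0,c')(0,b,c) = (0,a'b,c'c) and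
     (0,b',c')(a,b,c) = (0,b'c,c'c), where 0 absorbs.
   - r = true: the quotient of the former by the congruence identifying with 0
     the constant maps occurring as components a or b (not c); a morphism is
     represented by the triple in which a and b are 0 or non-constant.
   The quotient is needed for T_0 = Id and for T_1 to be an anti-chain map.
   Over the category r = false, the shuffle formula for T_0 gives the action of
   e = (0,const,Id) : (0,l) -> (0,l), not of the identity; T = \sum_k T_k is a
   chain map for this T_0, but in general not for T_0 = Id; and T_1 fails to
   anticommute with the differentials by \partial' T_0, which involves the two
   morphisms (eps_i,0,Id)e : (0,l) -> (1,l).  Identifying e with the identity
   and (eps_0,0,Id) with (eps_1,0,Id) generates exactly the congruence above. *)
Section DeltaTwo.
Variable r : bool.

Definition collapse k l (a : dhom k l) : option (dhom k l) :=
  if r && is_const a then None else Some a.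

Definition ocomp k l m (g : option (dhom l m)) (f : option (dhom k l)) :
    option (dhom k m) :=
  match g, f with
  | Some g', Some f' => collapse (dcomp g' f')
  | _, _ => None
  end.

Definition is_hom (i j : obj)
    (t : option (dhom i.1 j.1) * option (dhom i.2 j.1) * dhom i.2 j.2) : bool :=
  [&& (t.1.1 == None) || (t.1.2 == None),
      obind (@collapse _ _) t.1.1 == t.1.1 & obind (@collapse _ _) t.1.2 == t.1.2].

Definition hom (i j : obj) :=
  {t : option (dhom i.1 j.1) * option (dhom i.2 j.1) * dhom i.2 j.2 | is_hom t}.

Definition mkhom (i j : obj) t (h : @is_hom i j t) : hom i j :=
  exist (fun t => is_hom t) t h.

Lemma collapseK k l (a : dhom k l) : obind (@collapse _ _) (collapse a) = collapse a.
Proof. by rewrite /collapse; case: ifP => //= ->. Qed.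

Lemma ocompK k l m (g : option (dhom l m)) (f : option (dhom k l)) :
  obind (@collapse _ _) (ocomp g f) = ocomp g f.
Proof. by case: g f => [g|] [f|] //=; exact: collapseK. Qed.

Lemma homa_subproof (i j : obj) (a : dhom i.1 j.1) (c : dhom i.2 j.2) :
  @is_hom i j (collapse a, None, c).
Proof. by rewrite /is_hom /= collapseK !eqxx orbT. Qed.

Definition homa (i j : obj) (a : dhom i.1 j.1) (c : dhom i.2 j.2) : hom i j :=
  mkhom (homa_subproof a c).

Lemma homb_subproof (i j : obj) (b : dhom i.2 j.1) (c : dhom i.2 j.2) :
  @is_hom i j (None, collapse b, c).
Proof. by rewrite /is_hom /= collapseK !eqxx. Qed.

Definition homb (i j : obj) (b : dhom i.2 j.1) (c : dhom i.2 j.2) : hom i j :=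
  mkhom (homb_subproof b c).

Definition hid (i : obj) : hom i i := homa (did i.1) (did i.2).

Definition hcomp_val (i j k : obj) (g : hom j k) (f : hom i j) :
    option (dhom i.1 k.1) * option (dhom i.2 k.1) * dhom i.2 k.2 :=
  let: (a', b', c') := val g in
  let: (a, b, c) := val f in
  (ocomp a' a,
   if b' is Some _ then ocomp b' (Some c) else ocomp a' b,
   dcomp c' c).

Lemma hcomp_subproof (i j k : obj) (g : hom j k) (f : hom i j) :
  is_hom (hcomp_val g f).
Proof.
rewrite /hcomp_val; case: g f => -[[a' b'] c'] /= /and3P[/= h1 _ _].
case=> -[[a b] c] /= /and3P[/= h2 _ _]; rewrite /is_hom /= ocompK eqxx /=.
apply/andP; split; last by case: b' h1 => *; rewrite ocompK.
case: b' h1 => [b'|_]; first by rewrite orbF => /eqP ->.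
by case/orP: h2 => /eqP ->; case: a' => //= *; rewrite ?orbT.
Qed.

Definition hcomp (i j k : obj) (g : hom j k) (f : hom i j) : hom i k :=
  mkhom (hcomp_subproof g f).

Lemma dcompf1 k l (f : dhom k l) : dcomp f (did k) = f.
Proof. by apply/val_inj/ffunP => i; rewrite !ffunE. Qed.

Lemma dcomp1f k l (f : dhom k l) : dcomp (did l) f = f.
Proof. by apply/val_inj/ffunP => i; rewrite !ffunE. Qed.

Lemma is_const_did_l k l (f : dhom k l) : is_const (did l) -> is_const f.
Proof.
move=> /forallP h; have h0 (x : 'I_l.+1) : x = ord0.
  by have := h x; rewrite !ffunE => /eqP.
by apply/forallP => i; rewrite [val f i]h0 [val f ord0]h0.
Qed.

Lemma is_const_did_r k l (f : dhom k l) : is_const (did k) -> is_const f.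
Proof.
move=> /forallP h; apply/forallP => i.
by have := h i; rewrite !ffunE => /eqP ->.
Qed.

Lemma ocomp1f k l (f : option (dhom k l)) :
  obind (@collapse _ _) f = f -> ocomp (collapse (did l)) f = f.
Proof.
case: f => [f|] /=; last by case: collapse.
rewrite {2}/collapse; case: ifP => [/andP[hr hc]|_]; last by rewrite /= dcomp1f.
by rewrite /collapse hr (is_const_did_l f hc).
Qed.

Lemma ocompf1 k l (f : option (dhom k l)) :
  obind (@collapse _ _) f = f -> ocomp f (collapse (did k)) = f.
Proof.
case: f => [f|] //=.
rewrite {2}/collapse; case: ifP => [/andP[hr hc]|_]; last by rewrite dcompf1.
by rewrite /collapse hr (is_const_did_r f hc).
Qed.

Lemma hcomp1f (i j : obj) (f : hom i j) : hcomp (hid j) f = f.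
Proof.
apply: val_inj; case: f => -[[a b] c] h /=; have /and3P[/= _ /eqP ha /eqP hb] := h.
by rewrite /hcomp_val /= !ocomp1f // dcomp1f.
Qed.

Lemma hcompf1 (i j : obj) (f : hom i j) : hcomp f (hid i) = f.
Proof.
apply: val_inj; case: f => -[[a b] c] h /=; have /and3P[/= _ /eqP ha /eqP hb] := h.
rewrite /hcomp_val /= ocompf1 // dcompf1; congr (_, _, _).
by case: b hb {h} => [b|_] /=; rewrite ?dcompf1 //; case: a {ha}.
Qed.

(* a morphism i -> j has degree weight j - weight i *)
Definition weight (i : obj) : nat := (i.1 + i.2)%N.

(* the morphisms (Id,0,eps_i) and (eps_i,0,Id) *)
Definition hface k p (i : 'I_p.+2) : hom (k, p) (k, p.+1) :=
  @homa (k, p) (k, p.+1) (did k) (dface i).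

Definition vface k p (i : 'I_k.+2) : hom (k, p) (k.+1, p) :=
  @homa (k, p) (k.+1, p) (dface i) (did p).

Lemma hface_weight k p : (weight (k, p) <= weight (k, p.+1))%N.
Proof. by rewrite /weight /= addnS. Qed.

Lemma vface_weight k p : (weight (k, p) <= weight (k.+1, p))%N.
Proof. by rewrite /weight /= addSn. Qed.

(* (k,l)-shuffles; {1, ..., k+l} is shifted to {0, ..., k+l-1} *)
Definition is_shuffle k l (s : 'S_(k + l)) : bool :=
  [forall i : 'I_(k + l), forall j : 'I_(k + l),
     ((i < j)%N && ((j < k)%N || (k <= i)%N)) ==> (s i < s j)%N].

Definition shuffle_bset k l (s : 'S_(k + l)) (i : nat) : {set 'I_(k + l)} :=
  [set j : 'I_(k + l) | (j < k)%N && (s j < i)%N]%SET.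

Definition shuffle_cset k l (s : 'S_(k + l)) (i : nat) : {set 'I_(k + l)} :=
  [set j : 'I_(k + l) | (k <= j)%N && (s j < i)%N]%SET.

Lemma shuffle_b_bound k l (s : 'S_(k + l)) i : (#|shuffle_bset s i| < k.+1)%N.
Proof.
have e : #|[set @lshift k l j | j in 'I_k]%SET| = k.
  by rewrite card_imset ?card_ord //; exact: @lshift_inj k l.
rewrite ltnS -[leqRHS]e.
apply/subset_leq_card/fintype.subsetP => j; rewrite inE => /andP[hj _].
by apply/imsetP; exists (Ordinal hj) => //; apply: val_inj.
Qed.

Lemma shuffle_c_bound k l (s : 'S_(k + l)) i : (#|shuffle_cset s i| < l.+1)%N.
Proof.
have e : #|[set @rshift k l j | j in 'I_l]%SET| = l.
  by rewrite card_imset ?card_ord //; exact: @rshift_inj k l.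
rewrite ltnS -[leqRHS]e.
apply/subset_leq_card/fintype.subsetP => j; rewrite inE => /andP[hj _].
have hj' : (j - k < l)%N by rewrite ltn_subLR.
by apply/imsetP; exists (Ordinal hj') => //; apply: val_inj; rewrite /= subnKC.
Qed.

Lemma shuffle_b_subproof k l (s : 'S_(k + l)) :
  is_nondec [ffun i : 'I_(k + l).+1 => Ordinal (shuffle_b_bound s i)].
Proof.
apply/forallP => i; apply/forallP => j; apply/implyP => hij; rewrite !ffunE /=.
apply/subset_leq_card/fintype.subsetP => u; rewrite !inE => /andP[-> h] /=.
exact: leq_trans h hij.
Qed.

Lemma shuffle_c_subproof k l (s : 'S_(k + l)) :
  is_nondec [ffun i : 'I_(k + l).+1 => Ordinal (shuffle_c_bound s i)].
Proof.
apply/forallP => i; apply/forallP => j; apply/implyP => hij; rewrite !ffunE /=.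
apply/subset_leq_card/fintype.subsetP => u; rewrite !inE => /andP[-> h] /=.
exact: leq_trans h hij.
Qed.

(* b^s(i) = #(s({1,...,k}) \cap {1,...,i}), and similarly for c^s *)
Definition shuffle_b k l (s : 'S_(k + l)) : dhom (k + l) k :=
  mkdhom (shuffle_b_subproof s).

Definition shuffle_c k l (s : 'S_(k + l)) : dhom (k + l) l :=
  mkdhom (shuffle_c_subproof s).

Definition shuffle_hom k l (s : 'S_(k + l)) : hom (0%N, (k + l)%N) (k, l) :=
  @homb (0%N, (k + l)%N) (k, l) (shuffle_b s) (shuffle_c s).

Lemma shuffle_weight k l : (weight (0%N, (k + l)%N) <= weight (k, l))%N.
Proof. by []. Qed.

End DeltaTwo.

(* Only the morphisms of degree >= 0 are required to act; functoriality is
   not part of the data, but holds for the two instances below. *)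
Record coeffs (r : bool) := Coeffs {
  cgrp :> obj -> zmodType;
  cact : forall i j (f : hom r i j), (weight i <= weight j)%N ->
    {additive cgrp i -> cgrp j} }.

Section Operators.
Variables (r : bool) (G : coeffs r).

Definition hdiff_fun k p (x : G (k, p)) : G (k, p.+1) :=
  \sum_(i < p.+2) cact G (hface r k i) (hface_weight k p) x *~ (-1) ^+ i.

Lemma hdiff_funB k p : zmod_morphism (@hdiff_fun k p).
Proof.
move=> x y; rewrite /hdiff_fun -sumrB; apply: eq_bigr => i _.
by rewrite raddfB mulrzBl.
Qed.

(* \partial *)
Definition hdiff k p : {additive G (k, p) -> G (k, p.+1)} := mkadd (@hdiff_funB k p).

Definition vdiff_fun k p (x : G (k, p)) : G (k.+1, p) :=
  \sum_(i < k.+2) cact G (vface r p i) (vface_weight k p) x *~ (-1) ^+ i.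

Lemma vdiff_funB k p : zmod_morphism (@vdiff_fun k p).
Proof.
move=> x y; rewrite /vdiff_fun -sumrB; apply: eq_bigr => i _.
by rewrite raddfB mulrzBl.
Qed.

(* \partial' *)
Definition vdiff k p : {additive G (k, p) -> G (k.+1, p)} := mkadd (@vdiff_funB k p).

Definition shuffle_op_fun k l (x : G (0%N, (k + l)%N)) : G (k, l) :=
  \sum_(s : 'S_(k + l) | is_shuffle s)
     cact G (shuffle_hom r s) (shuffle_weight k l) x *~ (-1) ^+ odd_perm s.

Lemma shuffle_op_funB k l : zmod_morphism (@shuffle_op_fun k l).
Proof.
move=> x y; rewrite /shuffle_op_fun -sumrB; apply: eq_bigr => s _.
by rewrite raddfB mulrzBl.
Qed.

Definition shuffle_op k l : {additive G (0%N, (k + l)%N) -> G (k, l)} :=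
  mkadd (@shuffle_op_funB k l).

End Operators.
Record dspace (r : bool) := Dspace {
  dsp :> obj -> topologicalType;
  dpull : forall i j, hom r i j -> dsp j -> dsp i;
  dpull_continuous : forall i j (f : hom r i j), continuous (dpull f);
  dpull_id : forall i x, dpull (hid r i) x = x;
  dpull_comp : forall i j k (f : hom r i j) (g : hom r j k) x,
    dpull (hcomp g f) x = dpull f (dpull g x) }.

Record opens (T : topologicalType) := Opens {
  oset :> set T;
  oset_open : open oset }.

Definition opensT (T : topologicalType) : opens T := Opens (@openT T).

Definition opensI (T : topologicalType) (U V : opens T) : opens T :=
  Opens (openI (oset_open U) (oset_open V)).

Lemma opensIl (T : topologicalType) (U V : opens T) : opensI U V `<=` U.
Proof. exact: subIsetl. Qed.

Lemma opensIr (T : topologicalType) (U V : opens T) : opensI U V `<=` V.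
Proof. exact: subIsetr. Qed.

Record absheaf (T : topologicalType) := Absheaf {
  sec :> opens T -> zmodType;
  srst : forall U V : opens T, V `<=` U -> {additive sec U -> sec V};
  srst_id : forall (U : opens T) (h : U `<=` U) x, srst h x = x;
  srst_comp : forall (U V W : opens T) (h : V `<=` U) (h' : W `<=` V) (h'' : W `<=` U) x,
    srst h'' x = srst h' (srst h x);
  sglue : forall (I : Type) (W : opens T) (U : I -> opens T)
      (hU : forall i, U i `<=` W), W `<=` \bigcup_i U i ->
    forall s : forall i, sec (U i),
    (forall i j, srst (@opensIl _ (U i) (U j)) (s i) =
                 srst (@opensIr _ (U i) (U j)) (s j)) ->
    exists! t : sec W, forall i, srst (hU i) t = s i }.

Record dsheaf (r : bool) (M : dspace r) := Dsheaf {
  dsh :> forall i, absheaf (M i);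
  dstar : forall i j (f : hom r i j) (U : opens (M i)) (V : opens (M j)),
    dpull f @` V `<=` U -> {additive dsh i U -> dsh j V};
  dstar_id : forall i (U V : opens (M i)) (h : dpull (hid r i) @` V `<=` U)
      (h' : V `<=` U) x, dstar h x = srst (dsh i) h' x;
  dstar_comp : forall i j k (f : hom r i j) (g : hom r j k)
      (U : opens (M i)) (V : opens (M j)) (W : opens (M k))
      (hf : dpull f @` V `<=` U) (hg : dpull g @` W `<=` V)
      (hgf : dpull (hcomp g f) @` W `<=` U) x,
    dstar hgf x = dstar hg (dstar hf x) }.

Record sheafcpx (r : bool) (M : dspace r) := Sheafcpx {
  sheaf_at :> nat -> dsheaf M;
  sdiff : forall q i (U : opens (M i)),
    {additive sheaf_at q i U -> sheaf_at q.+1 i U};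
  sdiff_star : forall q i j (f : hom r i j) (U : opens (M i)) (V : opens (M j))
      (h : dpull f @` V `<=` U) (x : sheaf_at q i U),
    sdiff q V (dstar (sheaf_at q) h x) = dstar (sheaf_at q.+1) h (sdiff q U x);
  sdiff_sdiff : forall q i (U : opens (M i)) x,
    sdiff q.+1 U (sdiff q U x) = 0 }.

Lemma dpull_opensT (r : bool) (M : dspace r) i j (f : hom r i j) :
  dpull f @` opensT (M j) `<=` opensT (M i).
Proof. by []. Qed.

Definition global_sections (r : bool) (M : dspace r) (A : dsheaf M) : coeffs r :=
  @Coeffs r (fun i => A i (opensT (M i)))
    (fun i j f _ => dstar A (@dpull_opensT r M i j f)).

Section SheafCochains.
Variables (r : bool) (M : dspace r) (A : sheafcpx M).

Local Notation Gam q := (global_sections (A q)).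

Definition sdiffT q i : {additive Gam q i -> Gam q.+1 i} := sdiff A q (opensT (M i)).

(* C^n(M_{k,.}; A_.), with family index (p, q) *)
Section Single.
Variable k : nat.

Definition sc_grp (i : nat * nat) : zmodType := Gam i.2 (k, i.1).
Definition sc_deg (i : nat * nat) : nat := (i.1 + i.2)%N.

Definition sc_diff_fun (x : dprod sc_grp) : dprod sc_grp := fun i =>
  match i return sc_grp i with
  | (p, q) =>
    match q return sc_grp (p, q) with
    | 0 => 0
    | q'.+1 => sdiffT q' (k, p) (x (p, q')) *~ (-1) ^+ p
    end +
    match p return sc_grp (p, q) with
    | 0 => 0
    | p'.+1 => hdiff (Gam q) k p' (x (p', q))
    end
  end.

Lemma sc_diff_funB : zmod_morphism sc_diff_fun.
Proof.
move=> x y; apply: dprodP => -[p q]; rewrite dprodB /sc_diff_fun opprD addrACA.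
congr (_ + _).
- by case: q => [|q]; [rewrite subrr | rewrite dprodB raddfB mulrzBl].
- by case: p => [|p]; [rewrite subrr | rewrite dprodB raddfB].
Qed.

Lemma sc_diff_deg n x :
  x \in in_degree sc_deg n -> sc_diff_fun x \in in_degree sc_deg n.+1.
Proof.
move=> /in_degreeP h; apply/in_degreeP => -[p q] hpq; rewrite /sc_diff_fun.
have hx a b : (a + b).+1 = (p + q)%N -> x (a, b) = 0.
  move=> e; apply: h; apply: contra hpq => /eqP /= <-.
  by rewrite /sc_deg /= -e.
rewrite [X in X + _](_ : _ = 0) ?add0r.
- by case: p hx {hpq} => [|p] hx //; rewrite hx ?raddf0.
- by case: q hx {hpq} => [|q] hx //; rewrite hx ?addnS // raddf0 mul0rz.
Qed.

Definition sc_cochains : cochains :=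
  @Cochains (fun n => gr sc_deg sc_grp n)
    (fun n => gr_map sc_diff_funB (@sc_diff_deg n)).

End Single.

(* C^n(M_{..}; A_.), with family index ((k, p), q) *)
Definition st_grp (i : obj * nat) : zmodType := Gam i.2 i.1.
Definition st_deg (i : obj * nat) : nat := (i.1.1 + i.1.2 + i.2)%N.

Definition st_diff_fun (x : dprod st_grp) : dprod st_grp := fun i =>
  match i return st_grp i with
  | ((k, p), q) =>
    match q return st_grp ((k, p), q) with
    | 0 => 0
    | q'.+1 => sdiffT q' (k, p) (x ((k, p), q')) *~ (-1) ^+ (k + p)
    end +
    match p return st_grp ((k, p), q) with
    | 0 => 0
    | p'.+1 => hdiff (Gam q) k p' (x ((k, p'), q)) *~ (-1) ^+ k
    end +
    match k return st_grp ((k, p), q) with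
    | 0 => 0
    | k'.+1 => vdiff (Gam q) k' p (x ((k', p), q))
    end
  end.

Lemma st_diff_funB : zmod_morphism st_diff_fun.
Proof.
move=> x y; apply: dprodP => -[[k p] q].
rewrite dprodB /st_diff_fun opprD addrACA; congr (_ + _).
  rewrite opprD addrACA; congr (_ + _).
  - by case: q => [|q]; [rewrite subrr | rewrite dprodB raddfB mulrzBl].
  - by case: p => [|p]; [rewrite subrr | rewrite dprodB raddfB mulrzBl].
by case: k => [|k]; [rewrite subrr | rewrite dprodB raddfB].
Qed.

Lemma st_diff_deg n x :
  x \in in_degree st_deg n -> st_diff_fun x \in in_degree st_deg n.+1.
Proof.
move=> /in_degreeP h; apply/in_degreeP => -[[k p] q] hpq; rewrite /st_diff_fun.
have hx a b c : (a + b + c).+1 = (k + p + q)%N -> x ((a, b), c) = 0.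
  move=> e; apply: h; apply: contra hpq => /eqP /= <-.
  by rewrite /st_deg /= -e.
rewrite [X in X + _ + _](_ : _ = 0) ?[X in _ + X + _](_ : _ = 0) ?add0r.
- by case: k hx {hpq} => [|k] hx //; rewrite hx ?raddf0.
- by case: p hx {hpq} => [|p] hx //; rewrite hx ?addnS // raddf0 mul0rz.
- by case: q hx {hpq} => [|q] hx //; rewrite hx ?addnS // raddf0 mul0rz.
Qed.

Definition st_cochains : cochains :=
  @Cochains (fun n => gr st_deg st_grp n)
    (fun n => gr_map st_diff_funB (@st_diff_deg n)).

(* T_k : C^n(M_{0,.}) -> C^{n-k}(M_{k,.}), for n = k + m; the target is 0 for
   n < k *)
Section Transgression.
Variable k : nat.

Definition sc_trans_fun (x : dprod (sc_grp 0)) : dprod (sc_grp k) := fun i =>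
  match i return sc_grp k i with
  | (p, q) => shuffle_op (Gam q) k p (x ((k + p)%N, q))
  end.

Lemma sc_trans_funB : zmod_morphism sc_trans_fun.
Proof.
move=> x y; apply: dprodP => -[p q].
by rewrite dprodB /sc_trans_fun dprodB raddfB.
Qed.

Lemma sc_trans_deg m x :
  x \in in_degree sc_deg (k + m) -> sc_trans_fun x \in in_degree sc_deg m.
Proof.
move=> /in_degreeP h; apply/in_degreeP => -[p q] hpq.
by rewrite /sc_trans_fun h ?raddf0 // /sc_deg /= -addnA eqn_add2l.
Qed.

Definition sc_trans m :
    {additive sc_cochains 0 (k + m)%N -> sc_cochains k m} :=
  gr_map sc_trans_funB (@sc_trans_deg m).

End Transgression.

(* T = \sum_k T_k; the component of T x in bidegree (k, p) is that of T_k x *)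
Definition st_trans_fun (x : dprod (sc_grp 0)) : dprod st_grp := fun i =>
  match i return st_grp i with
  | ((k, p), q) => sc_trans_fun k x (p, q)
  end.

Lemma st_trans_funB : zmod_morphism st_trans_fun.
Proof.
move=> x y; apply: dprodP => -[[k p] q].
by rewrite dprodB /st_trans_fun sc_trans_funB.
Qed.

Lemma st_trans_deg n x :
  x \in in_degree sc_deg n -> st_trans_fun x \in in_degree st_deg n.
Proof.
move=> /in_degreeP h; apply/in_degreeP => -[[k p] q] hpq.
by rewrite /st_trans_fun /sc_trans_fun h ?raddf0.
Qed.

Definition st_trans n : {additive sc_cochains 0 n -> st_cochains n} :=
  gr_map st_trans_funB (@st_trans_deg n).

End SheafCochains.

Section CechCovers.
Variables (r : bool) (M : dspace r).

(* a cover (U_x)_{x in M i} of M i, U_x an open neighbourhood of x, for each i *)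
Record ptcover := Ptcover {
  pnb : forall i, M i -> opens (M i);
  pnbP : forall i (x : M i), oset (pnb x) x }.

Definition ptcover_le (U V : ptcover) : Prop :=
  forall i (x : M i), pnb V x `<=` pnb U x.

Definition ptcover_top : ptcover :=
  @Ptcover (fun i _ => opensT (M i)) (fun i x => I).

Definition ptcover_sup (U V : ptcover) : ptcover :=
  @Ptcover (fun i x => opensI (pnb U x) (pnb V x))
    (fun i x => conj (pnbP U x) (pnbP V x)).

Lemma ptcover_refl U : ptcover_le U U.
Proof. by move=> i x. Qed.

Lemma ptcover_trans U V W :
  ptcover_le U V -> ptcover_le V W -> ptcover_le U W.
Proof. by move=> h h' i x y /h' /h. Qed.

Lemma ptcover_supl U V : ptcover_le U (ptcover_sup U V).
Proof. by move=> i x y []. Qed.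

Lemma ptcover_supr U V : ptcover_le V (ptcover_sup U V).
Proof. by move=> i x y []. Qed.

Definition ptcovers : dirset :=
  Dirset ptcover_top ptcover_refl ptcover_trans ptcover_supl ptcover_supr.

(* the index set \Lambda_j of \sigma U: families indexed by the morphisms of
   degree >= 0 with target j *)
Definition cech_index (j : obj) : Type :=
  forall i (f : hom r i j), (weight i <= weight j)%N -> M i.

Definition cech_set (U : ptcover) j (lam : cech_index j) : set (M j) :=
  [set y | forall i (f : hom r i j) (h : (weight i <= weight j)%N),
             oset (pnb U (lam i f h)) (dpull f y)].

Lemma cech_set_open U j (lam : cech_index j) : open (cech_set U lam).
Proof.
rewrite openE => y Vy; rewrite /interior.
pose P (a b : 'I_(weight j).+1) (f : hom r (nat_of_ord a, nat_of_ord b) j) :=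
  [set z : M j | forall h, oset (pnb U (lam _ f h)) (dpull f z)].
have nP a b f : nbhs y (P a b f).
  have [h|h] := boolP (weight (nat_of_ord a, nat_of_ord b) <= weight j)%N; last first.
    by apply: filterS filterT => z _ h'; rewrite h' in h.
  have : nbhs y (dpull f @^-1` pnb U (lam _ f h)).
    apply: (@dpull_continuous _ M _ _ f y); apply: open_nbhs_nbhs.
    by split; [exact: oset_open | exact: Vy].
  apply: filterS => z /= hz h'.
  by rewrite (bool_irrelevance h' h).
have : nbhs y [set z | forall a b f, P a b f z].
  by do 3![apply: filter_forall => ?]; exact: nP.
apply: filterS => z hz [a b] f h.
have ha : (a < (weight j).+1)%N by exact: leq_trans (leq_addr b a) h.
have hb : (b < (weight j).+1)%N by exact: leq_trans (leq_addl a b) h.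
exact: (hz (Ordinal ha) (Ordinal hb) f h).
Qed.

Definition cech_open U j (lam : cech_index j) : opens (M j) :=
  Opens (cech_set_open U lam).

Definition cech_index_pull i j (f : hom r i j) (h : (weight i <= weight j)%N)
    (lam : cech_index j) : cech_index i :=
  fun s g hg => lam s (hcomp f g) (leq_trans hg h).

Lemma cech_open_pull U i j (f : hom r i j) (h : (weight i <= weight j)%N) lam :
  dpull f @` cech_open U lam `<=` cech_open U (cech_index_pull f h lam).
Proof. by move=> _ [y hy <-] s g hg /=; rewrite -dpull_comp; apply: hy. Qed.

Lemma cech_open_le U V j (lam : cech_index j) :
  ptcover_le U V -> cech_open V lam `<=` cech_open U lam.
Proof. by move=> hUV y hy i f h; apply: hUV; exact: hy. Qed.

End CechCovers.

Section CechComplex.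
Variables (r : bool) (M : dspace r) (A : dsheaf M).

Lemma dstar_congr i j (f g : hom r i j) (U : opens (M i)) (V : opens (M j))
    (hf : dpull f @` V `<=` U) (hg : dpull g @` V `<=` U) x :
  f = g -> dstar A hf x = dstar A hg x.
Proof. by move=> e; case: g / e hg => hg; rewrite (Prop_irrelevance hf hg). Qed.

Lemma dstar_rst i j (f : hom r i j) (U U' : opens (M i)) (V V' : opens (M j))
    (h : dpull f @` V `<=` U) (h' : dpull f @` V' `<=` U')
    (hU : U' `<=` U) (hV : V' `<=` V) x :
  dstar A h' (srst (A i) hU x) = srst (A j) hV (dstar A h x).
Proof.
have hi : dpull (hid r i) @` U' `<=` U.
  by move=> _ [y hy <-]; rewrite dpull_id; exact: hU.
have hj : dpull (hid r j) @` V' `<=` V.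
  by move=> _ [y hy <-]; rewrite dpull_id; exact: hV.
rewrite -(dstar_id hi) -(dstar_id hj).
have h1 : dpull (hcomp f (hid r i)) @` V' `<=` U.
  by rewrite hcompf1 => _ [y hy <-]; apply: hU; apply: h'; exists y.
have h2 : dpull (hcomp (hid r j) f) @` V' `<=` U.
  by rewrite hcomp1f => _ [y hy <-]; apply: hU; apply: h'; exists y.
rewrite -(dstar_comp hi h' h1) -(dstar_comp h hj h2).
by apply: dstar_congr; rewrite hcompf1 hcomp1f.
Qed.

(* A(M'_j) = \prod_lam A(V_lam), for the cover \sigma U *)
Definition cech_grp (U : ptcover M) (j : obj) : zmodType :=
  dprod (fun lam : cech_index M j => A j (cech_open U lam)).

Section Action.
Variables (U : ptcover M) (i j : obj) (f : hom r i j).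
Hypothesis h : (weight i <= weight j)%N.

Definition cech_act_fun (x : cech_grp U i) : cech_grp U j :=
  fun lam => dstar A (cech_open_pull (f := f) h (lam := lam))
               (x (cech_index_pull f h lam)).

Lemma cech_act_funB : zmod_morphism cech_act_fun.
Proof. by move=> x y; apply: dprodP => lam; rewrite dprodB /cech_act_fun dprodB raddfB. Qed.

Definition cech_act : {additive cech_grp U i -> cech_grp U j} := mkadd cech_act_funB.

End Action.

Definition cech_coeffs (U : ptcover M) : coeffs r :=
  @Coeffs r (cech_grp U) (fun i j f h => cech_act U f h).

Section Refinement.
Variables (U V : ptcover M) (hUV : ptcover_le U V).

Definition cech_res_fun j (x : cech_coeffs U j) : cech_coeffs V j :=
  fun lam => srst (A j) (cech_open_le (lam := lam) hUV) (x lam).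

Lemma cech_res_funB j : zmod_morphism (@cech_res_fun j).
Proof. by move=> x y; apply: dprodP => lam; rewrite dprodB /cech_res_fun dprodB raddfB. Qed.

Definition cech_res j : {additive cech_coeffs U j -> cech_coeffs V j} :=
  mkadd (@cech_res_funB j).

Lemma cech_res_act i j (f : hom r i j) h x :
  cech_res j (cact (cech_coeffs U) f h x) = cact (cech_coeffs V) f h (cech_res i x).
Proof. by apply: dprodP => lam; apply/esym/dstar_rst. Qed.

End Refinement.

End CechComplex.

Section OperatorMorphism.
Variables (r : bool) (G G' : coeffs r).
Variable phi : forall i, {additive G i -> G' i}.
Hypothesis phi_act : forall i j (f : hom r i j) h x,
  phi j (cact G f h x) = cact G' f h (phi i x).

Lemma hdiff_morph k p x : phi _ (hdiff G k p x) = hdiff G' k p (phi _ x).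
Proof.
by rewrite /= /hdiff_fun raddf_sum; apply: eq_bigr => i _; rewrite raddfMz phi_act.
Qed.

Lemma vdiff_morph k p x : phi _ (vdiff G k p x) = vdiff G' k p (phi _ x).
Proof.
by rewrite /= /vdiff_fun raddf_sum; apply: eq_bigr => i _; rewrite raddfMz phi_act.
Qed.

Lemma shuffle_op_morph k l x :
  phi _ (shuffle_op G k l x) = shuffle_op G' k l (phi _ x).
Proof.
by rewrite /= /shuffle_op_fun raddf_sum; apply: eq_bigr => s _; rewrite raddfMz phi_act.
Qed.

Definition dmap_fun (x : dprod G) : dprod G' := fun i => phi i (x i).

Lemma dmap_funB : zmod_morphism dmap_fun.
Proof. by move=> x y; apply: dprodP => i; rewrite dprodB /dmap_fun dprodB raddfB. Qed.

Lemma dmap_deg n x :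
  x \in in_degree weight n -> dmap_fun x \in in_degree weight n.
Proof.
by move=> /in_degreeP h; apply/in_degreeP => i hi; rewrite /dmap_fun h ?raddf0.
Qed.

End OperatorMorphism.

(* \bigoplus_{k+p=n} G(k,p), its differential, and the map T into it *)
Section TotalComplex.
Variables (r : bool) (G : coeffs r).

Definition tot_diff_fun (x : dprod G) : dprod G := fun i =>
  match i return G i with
  | (k, p) =>
    match k return G (k, p) with
    | 0 => 0
    | k'.+1 => vdiff G k' p (x (k', p))
    end +
    match p return G (k, p) with
    | 0 => 0
    | p'.+1 => hdiff G k p' (x (k, p')) *~ (-1) ^+ k
    end
  end.

Lemma tot_diff_funB : zmod_morphism tot_diff_fun.
Proof.
move=> x y; apply: dprodP => -[k p]; rewrite dprodB /tot_diff_fun opprD addrACA.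
congr (_ + _).
- by case: k => [|k]; [rewrite subrr | rewrite dprodB raddfB].
- by case: p => [|p]; [rewrite subrr | rewrite dprodB raddfB mulrzBl].
Qed.

Lemma tot_diff_deg n x :
  x \in in_degree weight n -> tot_diff_fun x \in in_degree weight n.+1.
Proof.
move=> /in_degreeP h; apply/in_degreeP => -[k p] hkp; rewrite /tot_diff_fun.
have hx a b : (a + b).+1 = (k + p)%N -> x (a, b) = 0.
  move=> e; apply: h; apply: contra hkp => /eqP /= <-.
  by rewrite /weight /= -e.
rewrite [X in X + _](_ : _ = 0) ?add0r.
- by case: p hx {hkp} => [|p] hx //; rewrite hx ?addnS // raddf0 mul0rz.
- by case: k hx {hkp} => [|k] hx //; rewrite hx ?raddf0.
Qed.

Definition tot_diff n : {additive gr weight G n -> gr weight G n.+1} :=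
  gr_map tot_diff_funB (@tot_diff_deg n).

(* the component of T x in bidegree (k, p) is T_k x when k + p = n *)
Definition tot_trans_fun n (x : G (0%N, n)) : dprod G := fun i =>
  match i return G i with
  | (k, p) =>
    match @eqP _ (k + p)%N n with
    | ReflectT e => shuffle_op G k p (ecast m (G (0%N, m)) (esym e) x)
    | ReflectF _ => 0
    end
  end.

Lemma tot_trans_funB n : zmod_morphism (@tot_trans_fun n).
Proof.
move=> x y; apply: dprodP => -[k p]; rewrite dprodB /tot_trans_fun.
case: eqP => [e|_]; last by rewrite subrr.
by case: n / e x y => x y; exact: raddfB.
Qed.

Lemma tot_trans_deg n x : @tot_trans_fun n x \in in_degree weight n.
Proof.
apply/in_degreeP => -[k p]; rewrite /weight /= => /eqP h.
by case: eqP => [e|//]; case: (h e).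
Qed.

Definition tot_trans_grfun n (x : G (0%N, n)) : gr weight G n := Gr (tot_trans_deg x).

Lemma tot_trans_grfunB n : zmod_morphism (@tot_trans_grfun n).
Proof. by move=> x y; apply: val_inj; exact: tot_trans_funB. Qed.

Definition tot_trans n : {additive G (0%N, n) -> gr weight G n} :=
  mkadd (@tot_trans_grfunB n).

End TotalComplex.

Section TotalMorphism.
Variables (r : bool) (G G' : coeffs r).
Variable phi : forall i, {additive G i -> G' i}.
Hypothesis phi_act : forall i j (f : hom r i j) h x,
  phi j (cact G f h x) = cact G' f h (phi i x).

Definition tot_map n : {additive gr weight G n -> gr weight G' n} :=
  gr_map (dmap_funB phi) (@dmap_deg _ _ _ phi n).

Lemma tot_diff_morph n x : tot_map n.+1 (tot_diff G n x) = tot_diff G' n (tot_map n x).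
Proof.
apply/val_inj/dprodP => -[k p]; rewrite /= /dmap_fun /tot_diff_fun raddfD.
congr (_ + _).
- by case: k => [|k]; [rewrite raddf0 | rewrite vdiff_morph].
- by case: p => [|p]; [rewrite raddf0 | rewrite raddfMz hdiff_morph].
Qed.

Lemma tot_trans_morph n x : tot_map n (tot_trans G n x) = tot_trans G' n (phi _ x).
Proof.
apply/val_inj/dprodP => -[k p]; rewrite /= /dmap_fun /tot_trans_fun.
case: eqP => [e|_]; last by rewrite raddf0.
by case: n / e x => x; exact: shuffle_op_morph.
Qed.

End TotalMorphism.

Section CechCochains.
Variables (r : bool) (M : dspace r) (A : dsheaf M).

Local Notation CG U := (cech_coeffs A U).

Lemma cech_res_id (U : ptcover M) (h : ptcover_le U U) j x : cech_res A h j x = x.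
Proof. by apply: dprodP => lam; exact: srst_id. Qed.

Lemma cech_res_comp (U V W : ptcover M) (h : ptcover_le U V) (h' : ptcover_le V W)
    (h'' : ptcover_le U W) j x :
  cech_res A h'' j x = cech_res A h' j (cech_res A h j x).
Proof. by apply: dprodP => lam; exact: srst_comp. Qed.

Definition cc_sys (j : obj) : dirsys (ptcovers M) :=
  @Dirsys (ptcovers M) (fun U => CG U j) (fun U V h => cech_res A h j)
    (fun U h x => cech_res_id h x) (fun U V W h h' h'' x => cech_res_comp h h' h'' x).

Lemma ct_res_id n (U : ptcover M) (h : ptcover_le U U) x :
  tot_map (cech_res A h) n x = x.
Proof. by apply/val_inj/dprodP => i; exact: cech_res_id. Qed.

Lemma ct_res_comp n (U V W : ptcover M) (h : ptcover_le U V) (h' : ptcover_le V W)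
    (h'' : ptcover_le U W) x :
  tot_map (cech_res A h'') n x =
  tot_map (cech_res A h') n (tot_map (cech_res A h) n x).
Proof. by apply/val_inj/dprodP => i; exact: cech_res_comp. Qed.

Definition ct_sys (n : nat) : dirsys (ptcovers M) :=
  @Dirsys (ptcovers M) (fun U => gr weight (CG U) n)
    (fun U V h => tot_map (cech_res A h) n)
    (fun U h x => ct_res_id h x) (fun U V W h h' h'' x => ct_res_comp h h' h'' x).

Definition cc_hdiff k p : dirmor (cc_sys (k, p)) (cc_sys (k, p.+1)) :=
  @Dirmor _ (cc_sys (k, p)) (cc_sys (k, p.+1)) (fun U => hdiff (CG U) k p)
    (fun U V h x => esym (hdiff_morph (@cech_res_act _ _ A _ _ h) x)).

Definition ct_diff n : dirmor (ct_sys n) (ct_sys n.+1) :=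
  @Dirmor _ (ct_sys n) (ct_sys n.+1) (fun U => tot_diff (CG U) n)
    (fun U V h x => esym (tot_diff_morph (@cech_res_act _ _ A _ _ h) x)).

Definition cc_shuffle k l : dirmor (cc_sys (0%N, (k + l)%N)) (cc_sys (k, l)) :=
  @Dirmor _ (cc_sys (0%N, (k + l)%N)) (cc_sys (k, l)) (fun U => shuffle_op (CG U) k l)
    (fun U V h x => esym (shuffle_op_morph (@cech_res_act _ _ A _ _ h) x)).

Definition ct_total n : dirmor (cc_sys (0%N, n)) (ct_sys n) :=
  @Dirmor _ (cc_sys (0%N, n)) (ct_sys n) (fun U => tot_trans (CG U) n)
    (fun U V h x => esym (tot_trans_morph (@cech_res_act _ _ A _ _ h) x)).

Definition cc_cochains (k : nat) : cochains :=
  @Cochains (fun n => colim (cc_sys (k, n))) (fun n => colim_map (cc_hdiff k n)).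

Definition ct_cochains : cochains :=
  @Cochains (fun n => colim (ct_sys n)) (fun n => colim_map (ct_diff n)).

(* T_k on Cech cochains of degree n = k + m; it is 0 in degrees n < k *)
Definition cc_trans k m : {additive cc_cochains 0 (k + m)%N -> cc_cochains k m} :=
  colim_map (cc_shuffle k m).

Definition ct_trans n : {additive cc_cochains 0 n -> ct_cochains n} :=
  colim_map (ct_total n).

End CechCochains.

(* Main.v *)
From mathcomp Require Import all_boot all_order all_algebra.
From mathcomp Require Import perm ssrAC generic_quotient ring_quotient.
From mathcomp Require Import boolp classical_sets functions filter topology.
Require Import Defs.

(** Pulling back along the morphisms [(0, b, c)] turns cochains on the spaces
    [M_(0,n)] into functions on sequences of points of the grid
    [{0..k} x {0..l}]: a monotone path [w = (b 0, c 0), ..., (b n, c n)] acts by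
    [(0, b, c)].  A [(k,l)]-shuffle is a lattice path from [(0,0)] to [(k,l)],
    and [T_k] is the signed sum over these paths ([shuffle_opE]).  In this
    language the differential of the spaces [M_(0,n)] is the simplicial boundary
    that deletes a point of the path ([shuffle_op_hdiff]), while the two
    differentials of the double complex, applied to [T], shift the paths so that
    they skip a column or a row ([vdiff_shuffle_op], [hdiff_shuffle_op]).

    Hence everything reduces to the Eilenberg-Zilber identity
    [path_sum_bd]: the boundary of the signed sum of the lattice paths to
    [(k,l)] is the alternating sum, over the columns and the rows of the grid,
    of the sums of the paths that skip it.  In a pairing argument, deleting a
    corner cancels against the opposite corner, and deleting any other point
    leaves a path that skips exactly one row or column.  Here the identity is
    obtained by induction on the end point instead.  A path to
    [(k.+1, l.+1)] is a path to [(k, l.+1)] or to [(k.+1, l)] followed by its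
    end point ([path_sum_SS]; on permutations this is [lift_perm], which also
    gives the signs), and appending a point to a sequence changes its boundary by
    appending this point to all terms and by adding, up to sign, the sequence
    itself ([simplex_bd_rcons]).  The
    only terms that cancel are the two paths to [(k, l)] followed by
    [(k.+1, l.+1)], which arise from the last corner.

    The identity gives [T d = d T] for every functorial system of coefficients
    ([shuffle_op_bd]), in particular for the global sections and, for each
    cover, for the Cech cochains, so it passes to the direct limit.  In the
    reduced variant of the index category the only path to [(0, l)] acts as
    the identity, whence [T_0 = Id], and the two maps
    [M_(1,l) -> M_(0,l)] agree, so that [d' T_0 = 0] and the identity for
    [k = 1] says that [T_1] anticommutes with the differentials. *)

Set Implicit Arguments.
Unset Strict Implicit.
Unset Printing Implicit Defensive.

Import GRing.Theory.

Local Open Scope ring_scope.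

(** * Shuffles as lattice paths *)

Lemma reindex_lift_perm (V : zmodType) N (a b : 'I_N.+1) (P : pred 'S_N.+1)
    (f : 'S_N.+1 -> V) :
  \sum_(s : 'S_N.+1 | P s && (s a == b)) f s =
  \sum_(t : 'S_N | P (lift_perm a b t)) f (lift_perm a b t).
Proof.
rewrite (reindex (lift_perm a b)).
  by apply: eq_bigl => t; rewrite lift_perm_id eqxx andbT.
pose g i (s : 'S_N.+1) k := odflt k (unlift (s i) (s (lift i k))).
have gK i (s : 'S_N.+1) k : lift (s i) (g i s k) = s (lift i k).
  rewrite /g; have := neq_lift i k.
  by rewrite -(can_eq (permK s)) => /unlift_some[] ? ? ->.
have g_inj : injective (g a _).
  move=> s; apply: can_inj (g (s a) s^-1%g) _ => k.
  by rewrite {1}/g gK !permK liftK.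
exists (fun s => perm (g_inj s)) => [t _|s].
  by apply/permP => k; rewrite permE /g lift_perm_lift lift_perm_id liftK.
rewrite inE => /andP[_ /eqP sa]; apply/permP => k.
case: (unliftP a k) => [k'|] ->; rewrite ?lift_perm_id //.
by rewrite lift_perm_lift -sa permE gK.
Qed.

(** The [(k, N - k)]-shuffles.  Taking [N] rather than [k + l] as the parameter
    makes the removal of the last step well typed on either side, since
    [k + l.+1] and [(k + l).+1] are not convertible. *)
Definition shuffles k N : pred 'S_N := fun s =>
  [forall i : 'I_N, forall j : 'I_N,
     ((i < j)%N && ((j < k)%N || (k <= i)%N)) ==> (s i < s j)%N].

Lemma shufflesP k N (s : 'S_N) :
  reflect (forall i j : 'I_N, (i < j)%N -> (j < k)%N || (k <= i)%N -> (s i < s j)%N)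
          (shuffles k s).
Proof.
apply: (iffP forallP) => [h i j hij hk|h i].
  by have /forallP/(_ j)/implyP := h i; rewrite hij hk; apply.
by apply/forallP => j; apply/implyP => /andP[]; exact: h.
Qed.

Definition xpos k N (s : 'S_N) (i : nat) : nat :=
  #|[set j : 'I_N | (j < k)%N && (s j < i)%N]|.
Definition ypos k N (s : 'S_N) (i : nat) : nat :=
  #|[set j : 'I_N | (k <= j)%N && (s j < i)%N]|.

Definition path_of k N (s : 'S_N) : seq (nat * nat) :=
  mkseq (fun i => (xpos k s i, ypos k s i)) N.+1.

(** [s^-1] of the top value is the last element of the first or of the second
    block, as [s] increases on both. *)
Lemma shuffles_last k N (s : 'S_N.+1) (a : 'I_N.+1) :
  shuffles k s -> s a = ord_max -> (a.+1 == k) || (a == N :> nat).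
Proof.
move=> /shufflesP sh sa; apply/norP => -[ha hN].
have hb : (a.+1 < N.+1)%N by rewrite ltnS ltn_neqAle hN -ltnS /=.
have hk : ((Ordinal hb < k) || (k <= a))%N.
  by rewrite /= ltn_neqAle ha /=; case: leqP => // ->.
have := sh a (Ordinal hb) (ltnSn a) hk.
by rewrite sa ltnNge -ltnS ltn_ord.
Qed.

(** The second hypothesis says that [a] is the last element of its block for
    [k]; the first, that removing [a] turns the blocks for [k] into those for
    [k'].  So [k'] is [k.-1] or [k], according to the block of [a]. *)
Lemma shuffles_lift k k' N (a : 'I_N.+1) (t : 'S_N) :
  (forall i : 'I_N, (lift a i < k)%N = (i < k')%N) ->
  (forall j : 'I_N.+1, (a < j)%N -> ~~ ((j < k)%N || (k <= a)%N)) ->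
  shuffles k (lift_perm a ord_max t) = shuffles k' t.
Proof.
move=> hk hend; apply/shufflesP/shufflesP => sh i j hij.
  move=> hkij; have := sh (lift a i) (lift a j).
  rewrite !lift_perm_lift !lift_max; apply; first by rewrite /= ltnNge leq_bump2 -ltnNge.
  by rewrite [(k <= _)%N]leqNgt !hk -leqNgt.
case: (unliftP a i) hij => [i'|] -> hij.
  case: (unliftP a j) hij => [j'|] -> hij hkij.
    rewrite !lift_perm_lift !lift_max; apply: sh.
      by move: hij; rewrite /= !ltnNge leq_bump2.
    by move: hkij; rewrite [(k <= _)%N]leqNgt !hk -leqNgt.
  by rewrite lift_perm_lift lift_perm_id lift_max /= ltn_ord.
by move=> h; have := hend _ hij; rewrite h.
Qed.

Lemma card_ord_lift N (a : 'I_N.+1) (P : pred 'I_N.+1) :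
  #|[set j | P j]| = (P a + #|[set j | P (lift a j)]|)%N.
Proof.
rewrite !cardsE -!sum1_card !big_mkcond (bigD1_ord a) //=.
by rewrite [in RHS]big_mkcond.
Qed.

(** Removing the largest value of a shuffle removes the last step of its path,
    whose end point is always [(k, N.+1 - k)]. *)
Lemma path_of_lift k k' N (a : 'I_N.+1) (t : 'S_N) :
  (k <= N.+1)%N ->
  (forall i : 'I_N, (lift a i < k)%N = (i < k')%N) ->
  path_of k (lift_perm a ord_max t) = rcons (path_of k' t) (k, (N.+1 - k)%N).
Proof.
move=> hkN hk; rewrite /path_of mkseqS; congr rcons.
  apply: (@eq_from_nth _ (0%N, 0%N)); rewrite !size_mkseq // => i hi.
  rewrite !nth_mkseq // /xpos /ypos !(card_ord_lift a) lift_perm_id.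
  rewrite /= [(N < i)%N]ltnNge -[(i <= N)%N]ltnS hi !andbF !add0n.
  congr (_, _); apply: eq_card => j; rewrite !inE lift_perm_lift lift_max.
    by rewrite hk.
  by rewrite [(k <= _)%N]leqNgt hk -leqNgt.
have cardlt : #|[set j : 'I_N.+1 | (j < k)%N]| = k.
  have -> : [set j : 'I_N.+1 | (j < k)%N] = [set widen_ord hkN j | j in 'I_k].
    apply/setP => j; rewrite inE; apply/idP/imsetP => [h|[j' _ ->]].
      by exists (Ordinal h) => //; exact: val_inj.
    exact: (ltn_ord j').
  by rewrite card_imset ?card_ord // => i j /(congr1 val) e; apply: val_inj.
rewrite /xpos /ypos; congr (_, _).
  by rewrite -[RHS]cardlt; apply: eq_card => j; rewrite !inE ltn_ord andbT.
have -> : [set j : 'I_N.+1 | (k <= j)%N && (lift_perm a ord_max t j < N.+1)%N] =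
          ~: [set j : 'I_N.+1 | (j < k)%N].
  by apply/setP => j; rewrite !inE ltn_ord andbT leqNgt.
by rewrite cardsCs finset.setCK card_ord cardlt.
Qed.

Lemma signz_parity (V : zmodType) (x : V) m n :
  odd m = odd n -> x *~ (-1) ^+ m = x *~ (-1) ^+ n.
Proof. by move=> e; rewrite -signr_odd e signr_odd. Qed.

Lemma mulrz_signD (V : zmodType) (x : V) m n :
  x *~ (-1) ^+ m *~ (-1) ^+ n = x *~ (-1) ^+ (m + n).
Proof. by rewrite -mulrzA -exprD. Qed.

Lemma mulrz_signS (V : zmodType) (x : V) n :
  x *~ (-1) ^+ n.+1 = - (x *~ (-1) ^+ n).
Proof. by rewrite exprS mulN1r mulrNz. Qed.

Section ShuffleSum.
Variable V : zmodType.
Implicit Types (F : seq (nat * nat) -> V) (k l N : nat).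

(** The sum is a functional on all functions of point sequences, so that
    operations on paths become precompositions. *)
Definition shuffle_sum k N F : V :=
  \sum_(s : 'S_N | shuffles k s) F (path_of k s) *~ (-1) ^+ odd_perm s.

Lemma shuffle_sum_lift k k' N (a : 'I_N.+1) F :
  (k <= N.+1)%N ->
  (forall i : 'I_N, (lift a i < k)%N = (i < k')%N) ->
  (forall j : 'I_N.+1, (a < j)%N -> ~~ ((j < k)%N || (k <= a)%N)) ->
  \sum_(s : 'S_N.+1 | shuffles k s && (s^-1%g ord_max == a))
     F (path_of k s) *~ (-1) ^+ odd_perm s =
  shuffle_sum k' N (fun w => F (rcons w (k, (N.+1 - k)%N))) *~ (-1) ^+ (a + N).
Proof.
move=> hkN hk hend.
under eq_bigl => s do
  rewrite -(inj_eq (@perm_inj _ s)) permKV eq_sym.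
rewrite reindex_lift_perm mulrz_suml.
under eq_bigl => t do rewrite (shuffles_lift _ hk hend).
apply: eq_bigr => t _; rewrite (path_of_lift _ hkN hk) mulrz_signD.
by apply: signz_parity; rewrite odd_lift_perm !oddD !oddb addbC.
Qed.

Lemma shuffle_sum_split k N F :
  shuffle_sum k N.+1 F =
  \sum_(a : 'I_N.+1 | (a.+1 == k) || (a == N :> nat))
    \sum_(s : 'S_N.+1 | shuffles k s && (s^-1%g ord_max == a))
      F (path_of k s) *~ (-1) ^+ odd_perm s.
Proof.
apply: partition_big => s sh; apply: shuffles_last sh _.
by rewrite permKV.
Qed.

(** The signed sum over the lattice paths from [(0,0)] to [(k,l)]. *)
Definition path_sum k l F : V := shuffle_sum k (k + l) F.

Lemma path_sum_00 F : path_sum 0 0 F = F [:: (0, 0)%N].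
Proof.
rewrite /path_sum /shuffle_sum (big_pred1 (1%g : 'S_0)) => [|s]; last first.
  have -> : s = 1%g by apply/permP => -[].
  by rewrite /= eqxx; apply/shufflesP => -[].
rewrite odd_perm1 mulr1z /path_of /xpos /ypos; congr (F [:: (_, _)]);
  by apply: eq_card0 => -[].
Qed.

Lemma path_sum_S0 k F :
  path_sum k.+1 0 F = path_sum k 0 (fun w => F (rcons w (k.+1, 0%N))).
Proof.
rewrite /path_sum !addn0 shuffle_sum_split (big_pred1 ord_max) => [|a].
  rewrite (@shuffle_sum_lift _ k) // => [|i|j].
  - by rewrite subnn (@signz_parity _ _ _ 0) // addnn odd_double.
  - by rewrite lift_max ltnS ltnW //= ltn_ord.
  - by rewrite ltnNge -ltnS ltn_ord.
by rewrite eqSS orbb /= -val_eqE.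
Qed.

Lemma path_sum_0S l F :
  path_sum 0 l.+1 F = path_sum 0 l (fun w => F (rcons w (0%N, l.+1))).
Proof.
rewrite /path_sum !add0n shuffle_sum_split (big_pred1 ord_max) => [|a].
  rewrite (@shuffle_sum_lift _ 0) // => [|j].
  - by rewrite subn0 (@signz_parity _ _ _ 0) // addnn odd_double.
  - by rewrite ltnNge -ltnS ltn_ord.
by rewrite /= -val_eqE.
Qed.

(** The last step is vertical or horizontal.  Removing it is [lift_perm] at the
    end of the first block, which passes over the [l.+1] elements of the second
    one and contributes the sign, or at the end of the domain, without sign. *)
Lemma path_sum_SS k l F :
  path_sum k.+1 l.+1 F =
  path_sum k l.+1 (fun w => F (rcons w (k.+1, l.+1))) *~ (-1) ^+ l.+1 +
  path_sum k.+1 l (fun w => F (rcons w (k.+1, l.+1))).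
Proof.
rewrite /path_sum addSn shuffle_sum_split.
have hk : (k < (k + l.+1).+1)%N by rewrite ltnS leq_addr.
have hkN : (k < k + l.+1)%N by rewrite addnS ltnS leq_addr.
rewrite (bigD1 (Ordinal hk)) /= ?eqxx //; congr (_ + _).
  rewrite (@shuffle_sum_lift _ k) /= ?subSS ?addKn //.
  - by apply: signz_parity; rewrite addnA addnn oddD odd_double.
  - move=> i; rewrite /= /bump; case: (leqP k i) => h.
      by rewrite add1n ltnS ltnNge h.
    by rewrite add0n ltnS ltnW.
  - by move=> j h; rewrite negb_or -leqNgt -ltnNge h /=.
rewrite (big_pred1 ord_max) => [|a].
  rewrite (@shuffle_sum_lift _ k.+1) ?subSS ?addKn //.
  - by rewrite (@signz_parity _ _ _ 0) ?addSnnS // addnn odd_double.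
  - by move=> i; rewrite lift_max.
  - by move=> j; rewrite ltnNge -ltnS ltn_ord.
rewrite /= -(val_eqE a ord_max) -(val_eqE a (Ordinal hk)) /= eqSS.
by case: (a =P k :> nat) => [->|] /=; rewrite ?andbT // ltn_eqF.
Qed.

(** * The boundary of the sum of the lattice paths *)

Lemma eq_path_sum_in k l F F' :
  (forall w, size w = (k + l).+1 -> all (fun z => (z.1 <= k)%N && (z.2 <= l)%N) w ->
     F w = F' w) ->
  path_sum k l F = path_sum k l F'.
Proof.
move=> eqF; apply: eq_bigr => s _; rewrite eqF ?size_mkseq //.
apply/allP => _ /mapP[i _ ->] /=.
by rewrite -ltnS shuffle_b_bound -ltnS shuffle_c_bound.
Qed.

Lemma eq_path_sum k l F F' : F =1 F' -> path_sum k l F = path_sum k l F'.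
Proof. by move=> eqF; apply: eq_path_sum_in => w _ _. Qed.

Lemma path_sumD k l F F' :
  path_sum k l (fun w => F w + F' w) = path_sum k l F + path_sum k l F'.
Proof.
by rewrite -big_split; apply: eq_bigr => s _; rewrite mulrzDl.
Qed.

Lemma path_sumMz k l F n : path_sum k l (fun w => F w *~ n) = path_sum k l F *~ n.
Proof. by rewrite [RHS]mulrz_suml; apply: eq_bigr => s _; rewrite mulrzAC. Qed.

Definition delete i (w : seq (nat * nat)) := take i w ++ drop i.+1 w.

Definition simplex_bd F w : V := \sum_(i < size w) F (delete i w) *~ (-1) ^+ i.

Lemma simplex_bd_rcons F w z :
  simplex_bd F (rcons w z) =
  simplex_bd (fun w' => F (rcons w' z)) w + F w *~ (-1) ^+ size w.
Proof.
rewrite /simplex_bd size_rcons big_ord_recr /=; congr (_ + _).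
  apply: eq_bigr => i _; congr (F _ *~ _).
  rewrite /delete -!cats1 takel_cat ?(ltnW (ltn_ord i)) // -catA; congr cat.
  rewrite drop_cat; case: (ltngtP i.+1 (size w)) (ltn_ord i) => // -> _.
  by rewrite subnn drop0 drop_size.
by rewrite /delete -cats1 take_size_cat // drop_oversize ?cats0 // size_cat addn1.
Qed.

Lemma path_sum_bd_rcons k l F z :
  path_sum k l (fun w => simplex_bd F (rcons w z)) =
  path_sum k l (simplex_bd (fun w => F (rcons w z))) +
  path_sum k l F *~ (-1) ^+ (k + l).+1.
Proof.
rewrite -path_sumMz -path_sumD; apply: eq_path_sum_in => w sw _.
by rewrite simplex_bd_rcons sw.
Qed.

(** The faces [(eps_j, 0, Id)] and [(Id, 0, eps_j)] act on points by these maps. *)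
Definition vskip j (z : nat * nat) := (bump j z.1, z.2).
Definition hskip j (z : nat * nat) := (z.1, bump j z.2).

Definition skip_sum (skip : nat -> nat * nat -> nat * nat) m k l F : V :=
  \sum_(j < m) path_sum k l (fun w => F (map (skip j) w)) *~ (-1) ^+ j.

Lemma bump_lt j i : (i < j)%N -> bump j i = i.
Proof. by rewrite /bump ltnNge => /negbTE ->. Qed.

(** The points of a path to [(k,l)] have first coordinate at most [k], so that
    skipping the column [k.+1] does not move them. *)
Lemma vskip_sum_last k l F :
  skip_sum vskip k.+2 k l F =
  skip_sum vskip k.+1 k l F + path_sum k l F *~ (-1) ^+ k.+1.
Proof.
rewrite /skip_sum big_ord_recr /=; congr (_ + _ *~ _).
apply: eq_path_sum_in => w _ /allP hw; congr F; rewrite -[RHS]map_id.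
by apply/eq_in_map => -[a b] /hw/= /andP[ha _]; rewrite /vskip /= bump_lt.
Qed.

Lemma hskip_sum_last k l F :
  skip_sum hskip l.+2 k l F =
  skip_sum hskip l.+1 k l F + path_sum k l F *~ (-1) ^+ l.+1.
Proof.
rewrite /skip_sum big_ord_recr /=; congr (_ + _ *~ _).
apply: eq_path_sum_in => w _ /allP hw; congr F; rewrite -[RHS]map_id.
by apply/eq_in_map => -[a b] /hw/= /andP[_ hb]; rewrite /hskip /= bump_lt.
Qed.

(** The contributions of the columns and of the rows to the boundary of the sum
    of the paths to [(k,l)]; a grid of width or height 0 has no such paths. *)
Definition vboundary k l F : V :=
  if k is k'.+1 then skip_sum vskip k'.+2 k' l F else 0.
Definition hboundary k l F : V :=
  if l is l'.+1 then skip_sum hskip l'.+2 k l' F else 0.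

Lemma map_skip_rcons (skip : nat -> nat * nat -> nat * nat) j k l z z' F :
  skip j z = z' ->
  path_sum k l (fun w => F (map (skip j) (rcons w z))) =
  path_sum k l (fun w => F (rcons (map (skip j) w) z')).
Proof. by move=> e; apply: eq_path_sum => w; rewrite map_rcons e. Qed.

Lemma bump_ord n (j : 'I_n.+1) : bump j n = n.+1.
Proof. by rewrite /bump -ltnS ltn_ord. Qed.

Lemma vskip_sum_00 F : skip_sum vskip 1 0 0 F = F [:: (1, 0)%N].
Proof. by rewrite /skip_sum big_ord1 path_sum_00 mulr1z. Qed.

Lemma vskip_sum_S0 k F :
  skip_sum vskip k.+2 k.+1 0 F = vboundary k.+1 0 (fun w => F (rcons w (k.+2, 0%N))).
Proof.
apply: eq_bigr => j _; rewrite path_sum_S0; congr (_ *~ _).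
by apply: map_skip_rcons; rewrite /vskip bump_ord.
Qed.

(** The last column [k.+1] is left out on the left hand side: for the other
    columns the shifted paths end at [(k.+1, l.+1)], and removing this end point
    leaves the shift of a path to [(k.-1, l.+1)] or to [(k, l)].  For [k = 0] the
    former do not exist. *)
Lemma vskip_sum_S k l F :
  let Fz := fun w => F (rcons w (k.+1, l.+1)) in
  skip_sum vskip k.+1 k l.+1 F =
  vboundary k l.+1 Fz *~ (-1) ^+ l.+1 + skip_sum vskip k.+1 k l Fz.
Proof.
move=> Fz; case: k @Fz => [|k] Fz; last first.
  rewrite /= /skip_sum mulrz_suml -big_split; apply: eq_bigr => j _ /=.
  rewrite path_sum_SS mulrzDl mulrzAC; congr (_ *~ _ *~ _ + _ *~ _);
    by apply: map_skip_rcons; rewrite /vskip bump_ord.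
rewrite mul0rz add0r; apply: eq_bigr => j _; rewrite path_sum_0S; congr (_ *~ _).
by apply: map_skip_rcons; rewrite /vskip bump_ord.
Qed.

Lemma hskip_sum_00 F : skip_sum hskip 1 0 0 F = F [:: (0, 1)%N].
Proof. by rewrite /skip_sum big_ord1 path_sum_00 mulr1z. Qed.

Lemma hskip_sum_0S l F :
  skip_sum hskip l.+2 0 l.+1 F = hboundary 0 l.+1 (fun w => F (rcons w (0%N, l.+2))).
Proof.
apply: eq_bigr => j _; rewrite path_sum_0S; congr (_ *~ _).
by apply: map_skip_rcons; rewrite /hskip bump_ord.
Qed.

Lemma hskip_sum_S k l F :
  let Fz := fun w => F (rcons w (k.+1, l.+1)) in
  skip_sum hskip l.+1 k.+1 l F =
  skip_sum hskip l.+1 k l Fz *~ (-1) ^+ l + hboundary k.+1 l Fz.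
Proof.
move=> Fz; case: l @Fz => [|l] Fz; last first.
  rewrite /= /skip_sum mulrz_suml -big_split; apply: eq_bigr => j _ /=.
  rewrite path_sum_SS mulrzDl mulrzAC; congr (_ *~ _ *~ _ + _ *~ _);
    by apply: map_skip_rcons; rewrite /hskip bump_ord.
rewrite addr0 mulr1z; apply: eq_bigr => j _; rewrite path_sum_S0; congr (_ *~ _).
by apply: map_skip_rcons; rewrite /hskip bump_ord.
Qed.

(** Double induction on the end point.  The case [k = l = 0] is excluded, as the
    boundary of a one point sequence is the empty sequence rather than 0.  With
    an end point appended the empty sequence does contribute, and
    [vskip_sum_00] and [hskip_sum_00] account for it. *)
Theorem path_sum_bd k l F :
  (0 < k + l)%N ->
  path_sum k l (simplex_bd F) = vboundary k l F + hboundary k l F *~ (-1) ^+ k.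
Proof.
have bd1 (F' : seq (nat * nat) -> V) z : simplex_bd F' [:: z] = F' [::].
  by rewrite /simplex_bd big_ord1 mulr1z.
elim: k l F => [|k IHk].
  elim=> // l IHl F _.
  rewrite path_sum_0S path_sum_bd_rcons add0r mulr1z /= hskip_sum_last add0n.
  congr (_ + _); case: l IHl => [|l] IHl.
    by rewrite path_sum_00 bd1 hskip_sum_00.
  by rewrite IHl // add0r mulr1z hskip_sum_0S.
elim=> [|l IHl] F _.
  rewrite path_sum_S0 path_sum_bd_rcons mul0rz addr0 /= vskip_sum_last addn0.
  congr (_ + _); case: k IHk => [|k] IHk.
    by rewrite path_sum_00 bd1 vskip_sum_00.
  by rewrite IHk // mul0rz addr0 vskip_sum_S0.
rewrite path_sum_SS !path_sum_bd_rcons IHk ?addnS // IHl //= !vskip_sum_last !hskip_sum_last.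
rewrite vskip_sum_S hskip_sum_S /=.
set Fz := fun w => _; rewrite !mulrzDl !mulrz_signD.
(* the two occurrences of the last corner have opposite signs *)
have -> : path_sum k l Fz *~ (-1) ^+ (l.+1 + (k + l.+1)) =
          - (path_sum k l Fz *~ (-1) ^+ k.+1).
  rewrite mulrz_signS opprK; apply: signz_parity.
  by rewrite addnCA addnn oddD odd_double addbF.
have -> : path_sum k l.+1 F *~ (-1) ^+ ((k + l).+2 + l.+1) =
          path_sum k l.+1 F *~ (-1) ^+ k.+1.
  by apply: signz_parity; rewrite -addnS -addSn -addnA addnn oddD odd_double addbF.
have -> : ((k.+1 + l).+1 = l.+1 + k.+1)%N by rewrite -addnS addnC.
have -> : (l + k.+1 = k + l.+1)%N by rewrite addnC addSnnS.
by rewrite [LHS](AC (1*2*1*4) (1*5*4*(2*7*8)*(6*3)))%AC /= subrr addr0.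
Qed.

End ShuffleSum.

(** * Composition of the morphisms *)

Section Morphisms.
Variable r : bool.

Lemma const_compl k l m (g : dhom l m) (f : dhom k l) :
  is_const f -> is_const (dcomp g f).
Proof. by move=> /forallP h; apply/forallP => i; rewrite !ffunE (eqP (h i)). Qed.

Lemma const_compr k l m (g : dhom l m) (f : dhom k l) :
  is_const g -> is_const (dcomp g f).
Proof.
move=> /forallP h; apply/forallP => i.
by rewrite !ffunE (eqP (h (val f i))) (eqP (h (val f ord0))).
Qed.

Lemma dcompA k l m n (h : dhom m n) (g : dhom l m) (f : dhom k l) :
  dcomp h (dcomp g f) = dcomp (dcomp h g) f.
Proof. by apply/val_inj/ffunP => i; rewrite !ffunE. Qed.

(** A composite with a constant map is constant, so collapsing may be postponed to
    the end of a composition. *)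
Lemma ocomp_collapsel k l m (g : dhom l m) (f : dhom k l) :
  ocomp r (collapse r g) (Some f) = collapse r (dcomp g f).
Proof.
rewrite {1}/collapse; case: ifP => //= /andP[rT /const_compr h].
by rewrite /collapse rT h.
Qed.

Lemma ocomp_collapser k l m (g : dhom l m) (f : dhom k l) :
  ocomp r (Some g) (collapse r f) = collapse r (dcomp g f).
Proof.
rewrite {1}/collapse; case: ifP => //= /andP[rT /const_compl h].
by rewrite /collapse rT h.
Qed.

Lemma ocompA k l m n (h : option (dhom m n)) (g : option (dhom l m))
    (f : option (dhom k l)) :
  ocomp r h (ocomp r g f) = ocomp r (ocomp r h g) f.
Proof.
case: h g f => [h|] [g|] [f|] //; last by rewrite /=; case: collapse.
rewrite -[ocomp r (Some g) _]/(collapse r _) -[ocomp r (Some h) (Some g)]/(collapse r _).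
by rewrite ocomp_collapser ocomp_collapsel dcompA.
Qed.

Lemma ocompf0 k l m (g : option (dhom l m)) : ocomp r g (None : option (dhom k l)) = None.
Proof. by case: g. Qed.

Lemma hcompA (i j k l : obj) (h : hom r k l) (g : hom r j k) (f : hom r i j) :
  hcomp h (hcomp g f) = hcomp (hcomp h g) f.
Proof.
apply: val_inj; case: h g f => -[[a'' b''] c''] Hh [[[a' b'] c'] Hg] [[[a b] c] Hf].
rewrite /= /hcomp_val /= ocompA dcompA; congr (_, _, _).
case: b'' Hh => [b''|] /= Hh.
  have -> : a'' = None by move: Hh; rewrite /is_hom /= orbF => /andP[/eqP].
  by rewrite dcompA -ocomp_collapsel; case: collapse.
case: b' Hg => [b'|] /= Hg; last by rewrite ocompf0 ocompA.
have -> : a' = None by move: Hg; rewrite /is_hom /= orbF => /andP[/eqP].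
rewrite -[collapse r _]/(ocomp r (Some b') (Some c)) ocompA ocompf0.
by case: (ocomp r a'' (Some b')).
Qed.

Lemma hcomp_homb_homa (i j k : obj) (b : dhom j.2 k.1) (c : dhom j.2 k.2)
    (a : dhom i.1 j.1) (c' : dhom i.2 j.2) :
  hcomp (homb r b c) (homa r a c') = homb r (dcomp b c') (dcomp c c').
Proof.
apply: val_inj; rewrite /= /hcomp_val /=; congr (_, _, _).
by rewrite -ocomp_collapsel; case: collapse.
Qed.

Lemma hcomp_homa_homb (i j k : obj) (a : dhom j.1 k.1) (c' : dhom j.2 k.2)
    (b : dhom i.2 j.1) (c : dhom i.2 j.2) :
  hcomp (homa r a c') (homb r b c) = homb r (dcomp a b) (dcomp c' c).
Proof.
apply: val_inj; rewrite /= /hcomp_val /= ocompf0; congr (_, _, _).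
rewrite {1}/collapse; case: ifP => [/andP[rT h]|_]; last exact: ocomp_collapser.
by rewrite /= /collapse rT (const_compr _ h).
Qed.

End Morphisms.

(** * The boundary formula for functorial coefficients *)

Definition functorial r (G : coeffs r) :=
  forall i j k (f : hom r i j) (g : hom r j k) hf hg hgf x,
    cact G (hcomp g f) hgf x = cact G g hg (cact G f hf x).

Section Evaluation.
Variables (r : bool) (G : coeffs r).
Hypothesis actM : functorial G.

Implicit Types x : forall n, G (0%N, n).

Lemma cact_congr i j (f g : hom r i j) hf hg (x : G i) :
  f = g -> cact G f hf x = cact G g hg x.
Proof. by move=> e; case: g / e hg => hg; rewrite (bool_irrelevance hf hg). Qed.

Lemma cactM i j k (f : hom r i j) (g : hom r j k) hf hg hgf (x : G i) :
  cact G g hg (cact G f hf x) = cact G (hcomp g f) hgf x.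
Proof. by apply/esym/actM. Qed.

(** The action on [x] of the morphism [(0, b, c)] whose graph is the point
    sequence [w].  Taking a family [x] in all degrees at once, and totalizing with
    [inord] and 0 outside the graphs of such morphisms, makes this a plain
    function of [w], free of casts along the equations between lengths and
    degrees. *)
Definition chain_val x k p (w : seq (nat * nat)) : G (k, p) :=
  match insub [ffun i : 'I_(size w).-1.+1 => inord (nth (0, 0)%N w i).1]
          : option (dhom (size w).-1 k),
        insub [ffun i : 'I_(size w).-1.+1 => inord (nth (0, 0)%N w i).2]
          : option (dhom (size w).-1 p),
        @idP (weight (0%N, (size w).-1) <= weight (k, p))%N with
  | Some b, Some c, ReflectT h =>
      cact G (@homb r (0%N, (size w).-1) (k, p) b c) h (x _)
  | _, _, _ => 0
  end.

Definition traces n k p (b : dhom n k) (c : dhom n p) (w : seq (nat * nat)) :=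
  size w = n.+1 /\
  forall i : 'I_n.+1, nth (0, 0)%N w i = (val b i : nat, val c i : nat).

Lemma chain_valE x n k p (b : dhom n k) (c : dhom n p) h w :
  traces b c w ->
  chain_val x k p w = cact G (@homb r (0%N, n) (k, p) b c) h (x n).
Proof.
case=> sw; have e : (size w).-1 = n by rewrite sw.
case: n / e b c h {sw} => b c h hw; rewrite /chain_val.
have -> : [ffun i : 'I_(size w).-1.+1 => inord (nth (0, 0)%N w i).1] = val b.
  by apply/ffunP => i; rewrite ffunE hw inord_val.
have -> : [ffun i : 'I_(size w).-1.+1 => inord (nth (0, 0)%N w i).2] = val c.
  by apply/ffunP => i; rewrite ffunE hw inord_val.
rewrite !valK; case: {-}_ / idP => [h'|//].
by rewrite (bool_irrelevance h' h).
Qed.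

Lemma path_of_traces k l (s : 'S_(k + l)) :
  traces (shuffle_b s) (shuffle_c s) (path_of k s).
Proof.
split=> [|i]; first by rewrite size_mkseq.
by rewrite nth_mkseq // !ffunE.
Qed.

Lemma shuffle_opE x k p :
  shuffle_op G k p (x (k + p)%N) = path_sum k p (chain_val x k p).
Proof.
apply: eq_bigr => s _; congr (_ *~ _).
by rewrite (chain_valE _ (shuffle_weight k p) (path_of_traces s)).
Qed.

Lemma traces_delete n k p (b : dhom n.+1 k) (c : dhom n.+1 p) w (i : 'I_n.+2) :
  traces b c w -> traces (dcomp b (dface i)) (dcomp c (dface i)) (delete i w).
Proof.
case=> sw hw; have hi := ltn_ord i; split=> [|j].
  by rewrite size_cat size_take size_drop sw hi subSS subnKC // -ltnS.
rewrite nth_cat size_take sw hi !ffunE -hw /= /bump.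
case: (ltnP j i) => hji; first by rewrite nth_take.
by rewrite nth_drop add1n addSn subnKC.
Qed.

Lemma traces_vskip n k p (b : dhom n k) (c : dhom n p) w (j : 'I_k.+2) :
  traces b c w -> traces (dcomp (dface j) b) (dcomp (did p) c) (map (vskip j) w).
Proof.
case=> sw hw; split=> [|i]; first by rewrite size_map.
by rewrite (nth_map (0, 0)%N) ?sw // hw !ffunE.
Qed.

Lemma traces_hskip n k p (b : dhom n k) (c : dhom n p) w (j : 'I_p.+2) :
  traces b c w -> traces (dcomp (did k) b) (dcomp (dface j) c) (map (hskip j) w).
Proof.
case=> sw hw; split=> [|i]; first by rewrite size_map.
by rewrite (nth_map (0, 0)%N) ?sw // hw !ffunE.
Qed.

Definition hdiff_family x : forall n, G (0%N, n) :=
  fun n => if n is n'.+1 then hdiff G 0 n' (x n') else 0.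

(** Precomposing with the face [eps_i] deletes the [i]-th point of a path. *)
Lemma simplex_bdE x n k p (b : dhom n k) (c : dhom n p) h w :
  (0 < n)%N -> traces b c w ->
  cact G (@homb r (0%N, n) (k, p) b c) h (hdiff_family x n) =
  simplex_bd (chain_val x k p) w.
Proof.
case: n b c h => // n b c h _ tr; rewrite /simplex_bd (proj1 tr).
rewrite /= /hdiff_fun raddf_sum; apply: eq_bigr => i _.
have h' : (weight (0%N, n) <= weight (k, p))%N by exact: leq_trans h.
rewrite raddfMz (chain_valE _ h' (traces_delete i tr)); congr (_ *~ _).
rewrite (cactM _ _ _ _ h'); apply: cact_congr.
exact: hcomp_homb_homa.
Qed.

Lemma shuffle_op_hdiff x k p :
  (0 < k + p)%N ->
  shuffle_op G k p (hdiff_family x (k + p)) =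
  path_sum k p (simplex_bd (chain_val x k p)).
Proof.
move=> kp0; apply: eq_bigr => s _; congr (_ *~ _).
by rewrite (simplex_bdE _ _ kp0 (path_of_traces s)).
Qed.

Lemma vdiff_shuffle_op x k p :
  vdiff G k p (shuffle_op G k p (x (k + p)%N)) =
  skip_sum vskip k.+2 k p (chain_val x k.+1 p).
Proof.
apply: eq_bigr => j _; congr (_ *~ _); rewrite raddf_sum; apply: eq_bigr => s _.
have h : (weight (0%N, (k + p)%N) <= weight (k.+1, p))%N by exact: leqnSn.
rewrite raddfMz (chain_valE _ h (traces_vskip j (path_of_traces s))); congr (_ *~ _).
by rewrite (cactM _ _ _ _ h); apply: cact_congr; exact: hcomp_homa_homb.
Qed.

Lemma hdiff_shuffle_op x k p :
  hdiff G k p (shuffle_op G k p (x (k + p)%N)) =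
  skip_sum hskip p.+2 k p (chain_val x k p.+1).
Proof.
apply: eq_bigr => j _; congr (_ *~ _); rewrite raddf_sum; apply: eq_bigr => s _.
have h : (weight (0%N, (k + p)%N) <= weight (k, p.+1))%N.
  by rewrite /weight /= addnS.
rewrite raddfMz (chain_valE _ h (traces_hskip j (path_of_traces s))); congr (_ *~ _).
by rewrite (cactM _ _ _ _ h); apply: cact_congr; exact: hcomp_homa_homb.
Qed.

(** This is the component of [T d = d T] in bidegree [(k, p)].  In total degree 0
    both sides vanish. *)
Theorem shuffle_op_bd x k p :
  shuffle_op G k p (hdiff_family x (k + p)) =
  match k return G (k, p) with
  | 0 => 0
  | k'.+1 => vdiff G k' p (shuffle_op G k' p (x (k' + p)%N))
  end +
  match p return G (k, p) with
  | 0 => 0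
  | p'.+1 => hdiff G k p' (shuffle_op G k p' (x (k + p')%N)) *~ (-1) ^+ k
  end.
Proof.
have [/eqP|kp0] := posnP (k + p).
  by rewrite addn_eq0 => /andP[/eqP-> /eqP->]; rewrite raddf0 addr0.
rewrite shuffle_op_hdiff // path_sum_bd //; congr (_ + _).
  by case: k {kp0} => // k; rewrite vdiff_shuffle_op.
by case: p {kp0} => [|p]; rewrite ?mul0rz // hdiff_shuffle_op.
Qed.

Lemma family_through p (y : G (0%N, p)) :
  exists2 x : forall n, G (0%N, n), x p = y & forall n, n != p -> x n = 0.
Proof.
exists (fun n => if p =P n is ReflectT e then ecast m (G (0%N, m)) e y else 0).
  by case: eqP => // e; rewrite eq_axiomK.
by move=> n np; case: eqP => // e; rewrite e eqxx in np.
Qed.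

Lemma tot_trans_funE x n k p :
  (forall m, m != n -> x m = 0) ->
  tot_trans_fun (x n) (k, p) = shuffle_op G k p (x (k + p)%N).
Proof.
move=> x0; rewrite /tot_trans_fun; case: eqP => [e|/eqP/x0 ->]; last by rewrite raddf0.
by case: n / e x0.
Qed.

(** An element of degree [n] is extended by 0 to a family, so that the case
    distinction on [k + p = n] in the definition of [T] disappears. *)
Lemma tot_trans_chain n (y : G (0%N, n)) :
  tot_diff G n (tot_trans G n y) = tot_trans G n.+1 (hdiff G 0 n y).
Proof.
have [x <- x0] := family_through y.
have dx0 m : m != n.+1 -> hdiff_family x m = 0.
  by case: m => // m mn; rewrite /hdiff_family x0 // raddf0.
apply/val_inj/dprodP => -[k p].
apply: etrans (esym (tot_trans_funE k p dx0)).
rewrite shuffle_op_bd /=; congr (_ + _).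
  by case: k => // k; congr (vdiff_fun _); exact: (tot_trans_funE k p x0).
by case: p => // p; congr (hdiff_fun _ *~ _); exact: (tot_trans_funE k p x0).
Qed.

Hypothesis rT : r.

Lemma collapse_const k l (a : dhom k l) : is_const a -> collapse r a = None.
Proof. by rewrite /collapse rT => ->. Qed.

Lemma is_const_to0 k (a : dhom k 0) : is_const a.
Proof. by apply/forallP => i; rewrite !ord1. Qed.

Lemma is_const_from0 l (a : dhom 0 l) : is_const a.
Proof. by apply/forallP => i; rewrite ord1. Qed.

Lemma nondec_to0 k : is_nondec [ffun _ : 'I_k.+1 => ord0 : 'I_1].
Proof. by apply/forallP => i; apply/forallP => j; rewrite !ffunE leqnn implybT. Qed.

Hypothesis act1 : forall i h (y : G i), cact G (hid r i) h y = y.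

(** There is one lattice path to [(0, p)], the graph of the constant map and the
    identity; after collapsing the constant, [(0, const, Id)] is the identity. *)
Lemma shuffle_op_0 p (y : G (0%N, p)) : shuffle_op G 0 p y = y.
Proof.
have diag (V : zmodType) (F : seq (nat * nat) -> V) l :
    path_sum 0 l F = F (mkseq (fun i => (0%N, i)) l.+1).
  elim: l F => [|l IHl] F; first exact: path_sum_00.
  by rewrite path_sum_0S IHl -mkseqS.
have [x <- _] := family_through y.
pose b : dhom (0 + p) 0 := mkdhom (nondec_to0 (0 + p)).
have tr : traces b (did p) (mkseq (fun i => (0%N, i)) p.+1).
  by split=> [|i]; [rewrite size_mkseq | rewrite nth_mkseq // !ffunE].
rewrite (@shuffle_opE x 0 p) diag (chain_valE x (leqnn _) tr).
rewrite -[RHS](act1 (leqnn _)); apply: cact_congr.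
by apply: val_inj; rewrite /= !collapse_const // ?is_const_to0 ?is_const_from0.
Qed.

(** A map defined on [{0}] is constant, so the faces [(eps_0, 0, Id)] and
    [(eps_1, 0, Id)] are both collapsed to [(0, 0, Id)] and cancel. *)
Lemma vdiff_0 p (y : G (0%N, p)) : vdiff G 0 p y = 0.
Proof.
rewrite /= /vdiff_fun big_ord_recl big_ord1 mulr1z mulrN1z.
apply/eqP; rewrite subr_eq0; apply/eqP/cact_congr.
by apply: val_inj; rewrite /= !collapse_const ?is_const_from0.
Qed.

Lemma shuffle_op_1 p (y : G (0%N, p.+1)) :
  shuffle_op G 1 p.+1 (hdiff G 0 p.+1 y) = - hdiff G 1 p (shuffle_op G 1 p y).
Proof.
have [x <- _] := family_through y.
rewrite -[hdiff G 0 p.+1 _]/(hdiff_family x (1 + p.+1)) shuffle_op_bd.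
by rewrite vdiff_0 add0r mulrN1z.
Qed.

Lemma shuffle_op_10 (y : G (0%N, 0%N)) : shuffle_op G 1 0 (hdiff G 0 0 y) = 0.
Proof.
have [x <- _] := family_through y.
by rewrite -[hdiff G 0 0 _]/(hdiff_family x (1 + 0)) shuffle_op_bd vdiff_0 add0r.
Qed.

End Evaluation.

(** * Induced maps on cohomology *)

Lemma inducesP (s : nat) (C C' : cochains)
    (f : forall n, {additive C (s + n)%N -> C' n}) :
  (forall n x, cdiff x = 0 -> cdiff (f n x) = 0) ->
  (forall n x, is_coboundary x -> is_coboundary (f n x)) ->
  induces_on_coho f.
Proof.
move=> fZ fB.
pose g n (z : cocycles C (s + n)) : cocycles C' n :=
  Cocycle (introT eqP (fZ n (cocycle_val z) (elimT eqP (valP z)))).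
have gE n (z z' : cocycles C (s + n)) :
    (z == z' %[mod coho C (s + n)])%qT ->
    \pi_(coho C' n)%qT (g n z) = \pi_(coho C' n)%qT (g n z').
  rewrite -!Quotient.idealrBE => /asboolP hz; apply/eqP.
  rewrite -Quotient.idealrBE; apply/asboolP.
  by rewrite /= -raddfB; exact: fB.
pose F n (c : coho C (s + n)) : coho C' n := \pi_(coho C' n)%qT (g n (repr c)).
have FE n z : F n (\pi_(coho C (s + n))%qT z) = \pi_(coho C' n)%qT (g n z).
  by apply: gE; rewrite reprK.
have FB n : zmod_morphism (F n).
  move=> c c'; rewrite -[c]reprK -[c']reprK -raddfB !FE -raddfB; congr (\pi _)%qT.
  by apply: val_inj; exact: raddfB.
exists (fun n => mkadd (FB n)) => n x hx; exists (fZ n x hx).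
rewrite /= FE /coho_class; congr (\pi _)%qT.
exact: val_inj.
Qed.

Lemma chain_map_induces (C C' : cochains) (f : forall n, {additive C n -> C' n}) :
  chain_map f -> induces_on_coho (s := 0) f.
Proof.
move=> fd; apply: inducesP => n x; first by move=> dx; rewrite fd dx raddf0.
by case: n x => [|n] x /=; [move->; rewrite raddf0 | case=> y <-; exists (f n y); rewrite fd].
Qed.

Lemma antichain_map_induces (C C' : cochains) (f : forall n, {additive C n.+1 -> C' n}) :
  antichain_map f -> induces_on_coho (s := 1) f.
Proof.
case=> f0 fd; apply: inducesP => n x; first by move=> dx; rewrite fd dx raddf0 oppr0.
case: n x => [|n] x /= [y <-]; first exact: f0.
by exists (- f n y); rewrite raddfN fd opprK.
Qed.

(** * Complexes of sheaves *)

Section SheafTransgression.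
Variables (r : bool) (M : dspace r) (A : sheafcpx M).

Lemma global_sections_functorial (B : dsheaf M) : functorial (global_sections B).
Proof. by move=> i j k f g hf hg hgf x; exact: dstar_comp. Qed.

Lemma global_sections_act1 (B : dsheaf M) i h (y : global_sections B i) :
  cact (global_sections B) (hid r i) h y = y.
Proof.
by rewrite /= (dstar_id _ (@subset_refl _ (opensT (M i)))) srst_id.
Qed.

Lemma shuffle_op_sdiff q k p x :
  shuffle_op (global_sections (A q.+1)) k p (sdiffT A q _ x) =
  sdiffT A q _ (shuffle_op (global_sections (A q)) k p x).
Proof.
apply/esym/(@shuffle_op_morph _ _ _ (fun i => sdiffT A q i)) => i j f h y.
exact: sdiff_star.
Qed.

Lemma sc_diff_funE (x : dprod (sc_grp A 0)) p q :
  sc_diff_fun x (p, q) =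
  match q return sc_grp A 0 (p, q) with
  | 0 => 0
  | q'.+1 => sdiffT A q' (0%N, p) (x (p, q')) *~ (-1) ^+ p
  end + hdiff_family (G := global_sections (A q)) (fun n => x (n, q)) p.
Proof. by case: p. Qed.

(** The sheaf differential commutes with [T_k]; its sign [(-1) ^+ (k + p)] before
    [T_k] is the sign that it carries in the double complex. *)
Lemma sc_trans_fun_diff k (x : dprod (sc_grp A 0)) p q :
  sc_trans_fun k (sc_diff_fun x) (p, q) =
  match q return sc_grp A k (p, q) with
  | 0 => 0
  | q'.+1 => sdiffT A q' (k, p) (sc_trans_fun k x (p, q')) *~ (-1) ^+ (k + p)
  end +
  shuffle_op (global_sections (A q)) k p
    (hdiff_family (G := global_sections (A q)) (fun n => x (n, q)) (k + p)).
Proof.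
rewrite {1}/sc_trans_fun sc_diff_funE raddfD; congr (_ + _).
by case: q => [|q]; rewrite ?raddf0 // raddfMz shuffle_op_sdiff.
Qed.

Lemma st_trans_chain :
  chain_map (C := sc_cochains A 0) (C' := st_cochains A) (st_trans A).
Proof.
move=> n x; apply/val_inj/dprodP => -[[k p] q].
rewrite -[RHS]/(sc_trans_fun k (sc_diff_fun (gr_val x)) (p, q)) sc_trans_fun_diff.
rewrite shuffle_op_bd; last exact: global_sections_functorial.
by rewrite [X in _ = _ + X]addrC addrA.
Qed.

Hypothesis rT : r.

Lemma sc_trans_0 m (x : sc_cochains A 0 m) : sc_trans A 0 m x = x.
Proof.
apply/val_inj/dprodP => -[p q] /=.
by apply: shuffle_op_0 => // i h y; exact: global_sections_act1.
Qed.

Lemma sc_trans_fun_1 (x : dprod (sc_grp A 0)) i :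
  sc_trans_fun 1 (sc_diff_fun x) i = - sc_diff_fun (sc_trans_fun 1 x) i.
Proof.
case: i => p q; rewrite sc_trans_fun_diff /sc_diff_fun opprD; congr (_ + _).
  by case: q => [|q]; rewrite ?oppr0 // mulrz_signS.
have Gf := global_sections_functorial (B := A q).
case: p => [|p]; first by rewrite oppr0; exact: shuffle_op_10.
exact: shuffle_op_1.
Qed.

Lemma sc_trans_antichain :
  antichain_map (C := sc_cochains A 0) (C' := sc_cochains A 1) (sc_trans A 1).
Proof.
split=> [x|n x]; apply/val_inj/dprodP => i; last first.
  rewrite -[RHS]/(- sc_trans_fun 1 (sc_diff_fun (gr_val x)) i).
  by rewrite sc_trans_fun_1 opprK.
rewrite -[LHS]/(sc_trans_fun 1 (sc_diff_fun (gr_val x)) i) sc_trans_fun_1.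
(* an element of degree 0 has no component in the positive degree 1 + p + q *)
have -> : sc_trans_fun 1 (gr_val x) = 0.
  by apply: dprodP => -[p q]; rewrite /sc_trans_fun gr_out ?raddf0.
have := sc_diff_funB (0 : dprod (sc_grp A 1)) 0; rewrite !subrr => ->.
exact: oppr0.
Qed.

End SheafTransgression.

(** * Cech cochains *)

Section CechTransgression.
Variables (r : bool) (M : dspace r) (A : dsheaf M).
Implicit Types U : ptcover M.

Lemma cech_index_congr i j (lam : cech_index M j) (f g : hom r i j) hf hg :
  f = g -> lam i f hf = lam i g hg.
Proof. by move=> e; case: g / e hg => hg; rewrite (bool_irrelevance hf hg). Qed.

Lemma cech_index_pullM i j k (f : hom r i j) (g : hom r j k) hf hg hgf
    (lam : cech_index M k) :
  cech_index_pull f hf (cech_index_pull g hg lam) =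
  cech_index_pull (hcomp g f) hgf lam.
Proof.
do 3![apply: functional_extensionality_dep => ?].
by rewrite /cech_index_pull; apply: cech_index_congr; exact: hcompA.
Qed.

Lemma cech_index_pull1 i h (lam : cech_index M i) :
  cech_index_pull (hid r i) h lam = lam.
Proof.
do 3![apply: functional_extensionality_dep => ?].
by rewrite /cech_index_pull; apply: cech_index_congr; exact: hcomp1f.
Qed.

(** The two sides live over different open sets when the indices are only
    provably equal, so the equation is stated after restriction to a common
    target. *)
Lemma dstar_cech_congr U i j (f : hom r i j) (x : cech_grp A U i) (V : opens (M j))
    (lam lam' : cech_index M i)
    (h : (dpull f @` V `<=` cech_open U lam)%classic)
    (h' : (dpull f @` V `<=` cech_open U lam')%classic) :
  lam = lam' -> dstar A h (x lam) = dstar A h' (x lam').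
Proof. by move=> e; case: lam' / e h' => h'; rewrite (Prop_irrelevance h h'). Qed.

(** Functoriality of the index sets is associativity of composition in the index
    category, because an index is a family over all morphisms into an object. *)
Lemma cech_functorial U : functorial (cech_coeffs A U).
Proof.
move=> i j k f g hf hg hgf x; apply: dprodP => lam.
rewrite /= /cech_act_fun.
have h : (dpull (hcomp g f) @` cech_open U lam `<=`
          cech_open U (cech_index_pull f hf (cech_index_pull g hg lam)))%classic.
  by rewrite (cech_index_pullM f g hf hg hgf); exact: cech_open_pull.
rewrite -(dstar_comp _ _ h); apply: dstar_cech_congr.
exact/esym/cech_index_pullM.
Qed.

Lemma cech_act1 U i h (x : cech_coeffs A U i) : cact (cech_coeffs A U) (hid r i) h x = x.
Proof.
apply: dprodP => lam; rewrite /= /cech_act_fun.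
have h' : (dpull (hid r i) @` cech_open U lam `<=` cech_open U lam)%classic.
  by move=> _ [y hy <-]; rewrite dpull_id.
rewrite (dstar_cech_congr _ _ h') ?cech_index_pull1 //.
by rewrite (dstar_id _ (@subset_refl _ (cech_open U lam))) srst_id.
Qed.

Lemma cc_trans_in U k m (y : cc_sys A (0%N, (k + m)%N) U) :
  cc_trans A k m (colim_in y) =
  @colim_in _ (cc_sys A (k, m)) U (shuffle_op (cech_coeffs A U) k m y).
Proof. exact: (colim_map_funE (cc_shuffle A k m) y). Qed.

Lemma cc_diff_in U k n (y : cc_sys A (k, n) U) :
  @cdiff (cc_cochains A k) n (colim_in y) =
  @colim_in _ (cc_sys A (k, n.+1)) U (hdiff (cech_coeffs A U) k n y).
Proof. exact: (colim_map_funE (cc_hdiff A k n) y). Qed.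

Lemma ct_trans_in U n (y : cc_sys A (0%N, n) U) :
  ct_trans A n (colim_in y) =
  @colim_in _ (ct_sys A n) U (tot_trans (cech_coeffs A U) n y).
Proof. exact: (colim_map_funE (ct_total A n) y). Qed.

Lemma ct_diff_in U n (y : ct_sys A n U) :
  @cdiff (ct_cochains A) n (colim_in y) =
  @colim_in _ (ct_sys A n.+1) U (tot_diff (cech_coeffs A U) n y).
Proof. exact: (colim_map_funE (ct_diff A n) y). Qed.

Lemma ct_trans_chain :
  chain_map (C := cc_cochains A 0) (C' := ct_cochains A) (ct_trans A).
Proof.
move=> n x; have [U [y ->]] := colim_inP x.
rewrite cc_diff_in !ct_trans_in ct_diff_in.
exact: (congr1 (@colim_in _ (ct_sys A n.+1) U) (tot_trans_chain (@cech_functorial U) y)).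
Qed.

Hypothesis rT : r.

Lemma cc_trans_0 m (x : cc_cochains A 0 m) : cc_trans A 0 m x = x.
Proof.
have [U [y ->]] := colim_inP x; rewrite cc_trans_in; congr (colim_in _).
by apply: shuffle_op_0 => // i h z; exact: cech_act1.
Qed.

Lemma cc_trans_1S n (x : cc_cochains A 0 n.+1) :
  cdiff (cc_trans A 1 n x) = - cc_trans A 1 n.+1 (cdiff x).
Proof.
have [U [y ->]] := colim_inP x.
rewrite cc_diff_in !cc_trans_in cc_diff_in.
rewrite (shuffle_op_1 (@cech_functorial U)) //.
by apply: etrans _ (esym (colim_oppE _)); rewrite opprK.
Qed.

Lemma cc_trans_10 (x : cc_cochains A 0 0%N) : cc_trans A 1 0%N (cdiff x) = 0.
Proof.
have [U [y ->]] := colim_inP x.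
rewrite cc_diff_in cc_trans_in (shuffle_op_10 (@cech_functorial U)) //.
exact/esym/colim_zeroE.
Qed.

Lemma cc_trans_antichain :
  antichain_map (C := cc_cochains A 0) (C' := cc_cochains A 1) (cc_trans A 1).
Proof. by split; [exact: cc_trans_10 | exact: cc_trans_1S]. Qed.

End CechTransgression.

Theorem theoremC (reduced : bool) (M : dspace reduced) :
  [/\ (* 1 *)
      forall A : sheafcpx M,
        [/\ reduced -> forall m (x : sc_cochains A 0 m), sc_trans A 0 m x = x,
            chain_map (C := sc_cochains A 0) (C' := st_cochains A)
              (st_trans A)
          & induces_on_coho (s := 0) (C := sc_cochains A 0)
              (C' := st_cochains A) (st_trans A)],
      (* 2 *)
      reduced -> forall A : sheafcpx M,
        antichain_map (C := sc_cochains A 0) (C' := sc_cochains A 1)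
          (sc_trans A 1) /\
        induces_on_coho (s := 1) (C := sc_cochains A 0)
          (C' := sc_cochains A 1) (sc_trans A 1),
      (* 3 *)
      forall A : dsheaf M,
        [/\ reduced -> forall m (x : cc_cochains A 0 m), cc_trans A 0 m x = x,
            chain_map (C := cc_cochains A 0) (C' := ct_cochains A)
              (ct_trans A)
          & induces_on_coho (s := 0) (C := cc_cochains A 0)
              (C' := ct_cochains A) (ct_trans A)]
    & (* 4 *)
      reduced -> forall A : dsheaf M,
        antichain_map (C := cc_cochains A 0) (C' := cc_cochains A 1)
          (cc_trans A 1) /\
        induces_on_coho (s := 1) (C := cc_cochains A 0)
          (C' := cc_cochains A 1) (cc_trans A 1)].
Proof.
split=> [A|rT A|A|rT A]; split.
- by move=> rT m x; exact: sc_trans_0.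
- exact: st_trans_chain.
- by apply: chain_map_induces; exact: st_trans_chain.
- exact: sc_trans_antichain.
- by apply: antichain_map_induces; exact: sc_trans_antichain.
- by move=> rT m x; exact: cc_trans_0.
- exact: ct_trans_chain.
- by apply: chain_map_induces; exact: ct_trans_chain.
- exact: cc_trans_antichain.
- by apply: antichain_map_induces; exact: cc_trans_antichain.
Qed.
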